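(* Let $\pi=(d_1,\dots,d_n)$ be a $c$-cyclic degree sequence ($c\ge 0$) with $d_n=1$. Then there exists an extremal graph $G\in\Gamma(\pi)$ such that $G$ is a BFS-graph. Furthermore, when $c\ge 1$, such $G$ can be chosen (with vertices labeled $v_1,\dots,v_n$, $d(v_i)=d_i$, according to its BFS ordering) so that $\{v_1,v_2,v_3\}$ forms a triangle of $G$.
   Context: Graphs are finite, simple and connected; $N(v)$ is the neighbor set and $d(v)$ the degree of $v$. A connected graph with $n$ vertices and $n+c-1$ edges is $c$-cyclic; $\pi$ is a $c$-cyclic degree sequence if it is the non-increasing degree sequence of some connected $c$-cyclic graph, and $\Gamma(\pi)$ is the set of connected graphs with degree sequence $\pi$. For a graph with distinguished vertex $v_1$, $h(v)$ is the distance from $v$ to $v_1$. $G$ is a BFS-graph if there is an ordering $v_1\prec v_2\prec\cdots\prec v_n$ of $V(G)$ such that (i) $d(v_1)\ge\cdots\ge d(v_n)$ and $h(v_1)\le\cdots\le h(v_n)$; and (ii) whenever $v\in N(u)\setminus N(w)$, $z\in N(w)\setminus N(u)$ with $h(u)=h(w)=h(v)-1=h(z)-1$ and $u\prec w$, then $v\prec z$. For a symmetric function $f(x,y)$ on pairs of positive reals, $M_f(G)=\sum_{uv\in E(G)}f(d(u),d(v))$. $f$ is escalating if $f(x_1,x_2)+f(y_1,y_2)\ge f(x_2,y_1)+f(x_1,y_2)$ for all $x_1\ge y_1>0$, $x_2\ge y_2>0$, strictly whenever $x_1>y_1$ and $x_2>y_2$; de-escalating if the reverse inequality holds for all such values,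 strictly whenever $x_1>y_1$ and $x_2>y_2$. A fixed escalating or de-escalating $f$ is given; $G$ is an extremal graph of a class $\mathcal G$ if either $f$ is escalating and $M_f(G)=\max_{H\in\mathcal G}M_f(H)$, or $f$ is de-escalating and $M_f(G)=\min_{H\in\mathcal G}M_f(H)$. *)

(* Defs.v *)
From mathcomp Require Import all_boot all_order all_algebra.
From mathcomp Require Import reals.

Set Implicit Arguments.
Unset Strict Implicit.
Unset Printing Implicit Defensive.

Import Order.TTheory GRing.Theory Num.Theory.

Record graph := Graph {
  vert :> finType;
  adj : rel vert;
  adj_sym : symmetric adj;
  adj_irr : irreflexive adj
}.

Definition nbr (G : graph) (v : G) : {set G} := [set u | adj v u].

Definition deg (G : graph) (v : G) : nat := #|nbr v|.

Definition edges (G : graph) : {set {set G}} :=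
  [set [set p.1; p.2] | p : G * G & adj p.1 p.2].

Definition connected (G : graph) : Prop :=
  0 < #|G| /\ forall u v : G, connect (@adj G) u v.

Definition cyclic_graph (c : nat) (G : graph) : Prop :=
  connected G /\ #|edges G| = #|G| + c - 1.

Definition degseq (G : graph) : seq nat := sort geq [seq deg v | v <- enum G].

Definition cyclic_degseq (c : nat) (pi : seq nat) : Prop :=
  exists2 G : graph, cyclic_graph c G & degseq G = pi.

Definition Gamma (pi : seq nat) (G : graph) : Prop :=
  connected G /\ degseq G = pi.

Definition has_walk (G : graph) (u v : G) (k : nat) : bool :=
  [exists p : k.-tuple G, path (@adj G) u p && (last u p == v)].

(* The least length of a walk from u to v.  A shortest walk has fewer than #|G|
   edges; the value is #|G| when u and v are not connected. *)
Definition dist (G : graph) (u v : G) : nat := find (has_walk u v) (iota 0 #|G|).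

(* The ordering v_1 < ... < v_n is the duplicate-free list s = [:: v_1; ...; v_n]
   of all the vertices. *)
Definition before (G : graph) (s : seq G) (u w : G) : bool :=
  index u s < index w s.

Definition BFS_ordering (G : graph) (s : seq G) : Prop :=
  perm_eq s (enum G) /\
  if s is v1 :: _ then
    let h := dist v1 in
    [/\ sorted geq [seq deg v | v <- s],
        sorted leq [seq h v | v <- s] &
        forall u w v z : G,
          v \in nbr u :\: nbr w -> z \in nbr w :\: nbr u ->
          h w = h u -> h v = (h u).+1 -> h z = (h u).+1 ->
          before s u w -> before s v z]
  else False.

Definition BFS_graph (G : graph) : Prop := exists s : seq G, BFS_ordering s.

Local Open Scope ring_scope.

Definition symmetric_on_pos (R : realType) (f : R -> R -> R) : Prop :=
  forall x y : R, 0 < x -> 0 < y -> f x y = f y x.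

Definition escalating (R : realType) (f : R -> R -> R) : Prop :=
  forall x1 x2 y1 y2 : R, 0 < y1 -> y1 <= x1 -> 0 < y2 -> y2 <= x2 ->
    f x2 y1 + f x1 y2 <= f x1 x2 + f y1 y2 /\
    (y1 < x1 -> y2 < x2 -> f x2 y1 + f x1 y2 < f x1 x2 + f y1 y2).

Definition deescalating (R : realType) (f : R -> R -> R) : Prop :=
  forall x1 x2 y1 y2 : R, 0 < y1 -> y1 <= x1 -> 0 < y2 -> y2 <= x2 ->
    f x1 x2 + f y1 y2 <= f x2 y1 + f x1 y2 /\
    (y1 < x1 -> y2 < x2 -> f x1 x2 + f y1 y2 < f x2 y1 + f x1 y2).

(* The value f(d(u), d(v)) of an edge e = {u, v}; the order in which enum lists
   the two endpoints is irrelevant for symmetric f, and the default value 0 is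
   never used since edges have exactly two endpoints. *)
Definition edge_value (R : realType) (f : R -> R -> R) (G : graph)
    (e : {set G}) : R :=
  if enum e is [:: u; v] then f (deg u)%:R (deg v)%:R else 0.

Definition Mf (R : realType) (f : R -> R -> R) (G : graph) : R :=
  \sum_(e in edges G) edge_value f e.

Definition extremal (R : realType) (f : R -> R -> R) (C : graph -> Prop)
    (G : graph) : Prop :=
  C G /\
  ((escalating f /\ forall H : graph, C H -> Mf f H <= Mf f G) \/
   (deescalating f /\ forall H : graph, C H -> Mf f G <= Mf f H)).

(* Main.v *)
Require Import Defs.
From mathcomp Require Import all_boot all_order all_algebra.
From mathcomp Require Import reals boolp zify lra.

(** Label the vertices [0, ..., n-1] by non-increasing degree and choose, among the
    connected realizations of the degree sequence that are optimal for [f], one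
    that maximizes the sum of [i * j] over the edges [ij].  Swapping edges [ab, cd]
    for non-edges [ac, bd] with [a < d] and [c < b] never makes [f] worse and
    strictly increases the second sum, so each such swap must disconnect the graph.

    This alone gives the BFS property: if [u < w] although [w] is closer to the
    root, swaps of an edge from [w] to its parent with the edges at [u] force nearly
    all neighbours of [u] to be neighbours of [w], so [w] has larger degree.

    For the triangle write [r, p, q] for the first three vertices.  By counting
    edges, a cycle and a leaf give [r] degree at least 3, so [p] and [q] are
    neighbours of [r].  If [p] and [q] are not adjacent, swaps [pb, qd -> pq, bd]
    leave two possibilities.  Either some edge [pb] lies on a cycle; then [p], [q]
    lie in a piece hanging at [r] that is linked to [r] only through [p] and [q],
    and a third neighbour of [r] provides an improving swap.  Or all edges
    [pb], [qd] with [b, d <> r] are bridges; then every vertex of a branch behind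
    such a bridge precedes every vertex of a cycle outside the branch, hence has
    degree at least 2, so the branch contains a cycle itself; two disjoint branches
    then precede each other. *)

Set Implicit Arguments.
Unset Strict Implicit.
Unset Printing Implicit Defensive.

Ltac nlia :=
  repeat match goal with
  | H : ?P |- _ => lazymatch P with
    | is_true (leq _ _) => fail
    | @eq nat _ _ => fail
    | _ => clear H
    end
  end; lia.

(** * Connectivity in finite relations and deletion of an edge *)

Lemma mem_snd (T : eqType) (x y : T) : y \in [:: x; y].
Proof. by rewrite !inE eqxx orbT. Qed.

Lemma connect_ind (T : finType) (e : rel T) (P : T -> Prop) (x : T) :
  P x -> (forall y z, P y -> e y z -> P z) -> forall y, connect e x y -> P y.
Proof.
move=> Px Pe y /connectP[s]; elim: s x Px => [|z s IH] x Px /= => [_ -> //|].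
by case/andP=> /(Pe _ _ Px) Pz es; apply: IH.
Qed.

Lemma connect_hom (T T' : finType) (e : rel T) (e' : rel T') (phi : T -> T') :
  (forall x y, e x y -> connect e' (phi x) (phi y)) ->
  forall x y, connect e x y -> connect e' (phi x) (phi y).
Proof.
move=> ee' x; apply: connect_ind => // y z cxy /ee'; exact: connect_trans.
Qed.

Lemma connect_mono (T : finType) (e e' : rel T) :
  (forall x y, e x y -> e' x y) -> forall x y, connect e x y -> connect e' x y.
Proof. by move=> ee' x y; apply: connect_sub => u v /ee'; apply: connect1. Qed.

Lemma connect_first (T : finType) (e : rel T) (x y : T) :
  connect e x y -> x != y -> exists2 z, e x z & connect e z y.
Proof.
move=> /connectP[[|z s] /=]; first by move=> _ ->; rewrite eqxx.
by case/andP=> exz es -> _; exists z => //; apply/connectP; exists s.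
Qed.

Lemma connect_last (T : finType) (e : rel T) (x y : T) :
  connect e x y -> x != y -> exists2 z, connect e x z & e z y.
Proof.
move=> /connectP[s]; case/lastP: s => [|s z] /=; first by move=> _ ->; rewrite eqxx.
rewrite rcons_path last_rcons => /andP[es ez] -> _; exists (last x s) => //.
by apply/connectP; exists s.
Qed.

Definition del (T : eqType) (e : rel T) (a b : T) : rel T :=
  [rel x y | [&& e x y, ~~ ((x == a) && (y == b)) & ~~ ((x == b) && (y == a))]].

Lemma delI (T : eqType) (e : rel T) (a b x y : T) : e x y ->
  (x = a -> y = b -> False) -> (x = b -> y = a -> False) -> del e a b x y.
Proof.
move=> exy n1 n2; rewrite /del /= exy /=.
by apply/andP; split; apply/negP => /andP[/eqP ? /eqP ?]; [apply: n1|apply: n2].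
Qed.

Lemma delE (T : eqType) (e : rel T) (a b x y : T) : del e a b x y ->
  [/\ e x y, x = a -> y = b -> False & x = b -> y = a -> False].
Proof.
case/and3P=> exy n1 n2; split=> // ? ?; subst.
  by rewrite !eqxx in n1.
by rewrite !eqxx in n2.
Qed.

Lemma del_sym (T : eqType) (e : rel T) (a b : T) : symmetric e -> symmetric (del e a b).
Proof. by move=> es x y; rewrite /del /= es !(andbC (y == _)) (andbC (~~ _)). Qed.

Lemma delC (T : eqType) (e : rel T) (a b : T) : del e a b =2 del e b a.
Proof. by move=> x y; rewrite /del /= (andbC (~~ _)). Qed.

(** * Swap-optimal graphs *)

(* Once [ac] and [bd] are added, the graph without [ab] and [cd] is connected as
   soon as some vertex of [{a, c}] is joined to some vertex of [{b, d}]: the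
   condition says that swapping [ab, cd] for [ac, bd] disconnects the graph. *)
Definition swap_optimal (n : nat) (e : rel 'I_n) : Prop :=
  forall a b c d : 'I_n, e a b -> e c d -> a < d -> c < b ->
  ~~ e a c -> ~~ e b d -> a != c -> b != d ->
  forall x y, x \in [:: a; c] -> y \in [:: b; d] ->
  ~~ connect (del (del e a b) c d) x y.

Section LocallyOptimal.

Variables (n : nat) (e : rel 'I_n) (r : 'I_n) (h : 'I_n -> nat).
Hypothesis esym : symmetric e.
Hypothesis eirr : irreflexive e.
Hypothesis h0 : h r = 0.
Hypothesis hlip : forall x y, e x y -> h y <= (h x).+1.
Hypothesis hpar : forall x, x != r -> exists2 y, e x y & h x = (h y).+1.
Hypothesis r0 : nat_of_ord r = 0.

Let dg (x : 'I_n) := #|[set y | e x y]|.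

Hypothesis dmono : forall x y : 'I_n, x < y -> dg y <= dg x.
Hypothesis opt : swap_optimal e.

Lemma edge_neq x y : e x y -> x != y.
Proof. by apply: contraTneq => ->; rewrite eirr. Qed.

Lemma root_lt (x : 'I_n) : x != r -> r < x.
Proof. by rewrite -val_eqE /= r0 lt0n. Qed.

Lemma h_eq0 x : h x = 0 -> x = r.
Proof. by move=> hx; apply/eqP; apply/negPn/negP=> /hpar[y _]; rewrite hx. Qed.

Lemma low_connect k x : h x <= k ->
  connect [rel a b | [&& e a b, h a <= k & h b <= k]] x r.
Proof.
have [m] := ubnP (h x); elim: m x => // m IH x lm lk.
have [->|xr] := eqVneq x r; first exact: connect0.
have [y exy hy] := hpar xr.
apply: (@connect_trans _ _ y); last by apply: IH; nlia.
by apply: connect1; rewrite /= exy lk; nlia.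
Qed.

(** Each passage to a parent lowers [h], so after leaving [y] the walk stays strictly below the
    level of [x] and cannot meet it. *)
Lemma avoid_connect x y : h y <= h x -> y != x ->
  connect [rel a b | [&& e a b, a != x & b != x]] y r.
Proof.
have [m] := ubnP (h y); elim: m y => // m IH y lm lk yx.
have [->|yr] := eqVneq y r; first exact: connect0.
have [z eyz hz] := hpar yr.
have zx : z != x by apply: contraTneq lk => <-; nlia.
apply: (@connect_trans _ _ z); last by apply: IH => //; nlia.
by apply: connect1; rewrite /= eyz yx.
Qed.

Lemma symC (f : rel 'I_n) x y : symmetric f -> connect f x y -> connect f y x.
Proof. by move=> fs; rewrite (sym_connect_sym fs). Qed.

Lemma del2_sym a b c d : symmetric (del (del e a b) c d).
Proof. by do 2 apply: del_sym. Qed.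

Lemma dg_gt1 x y z : e x y -> e x z -> y != z -> 1 < dg x.
Proof.
move=> xy xz yz; rewrite /dg; have <- : #|[set y; z]| = 2 by rewrite cards2 yz.
by apply/subset_leq_card/subsetP => t; rewrite !inE => /orP[] /eqP->.
Qed.

Lemma dg_gt1_ex x y : 1 < dg x -> exists2 z, e x z & z != y.
Proof.
move=> d2; have : 0 < #|[set z | e x z] :\ y|.
  by move: d2; rewrite /dg (cardsD1 y); case: (_ \in _) => //; nlia.
by case/card_gt0P=> z; rewrite !inE => /andP[zy xz]; exists z.
Qed.

(* Swapping [w'w, ut] for [w'u, wt], where [w'] is a parent of [w], improves the
   graph unless it disconnects it; so [t] is adjacent to [w] for almost every
   neighbour [t] of [u], which makes the degree of [w] exceed that of [u]. *)
Lemma level_lt (w u : 'I_n) : h w < h u -> w < u.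
Proof.
have [m] := ubnP (h w); elim: m w u => // m IH w u lm lwu.
have ur : u != r by apply: contraTneq lwu => ->; rewrite h0.
have [->|wr] := eqVneq w r; first exact: root_lt.
case: (ltngtP w u) => // [uw|/val_inj wu]; last by move: lwu; rewrite wu ltnn.
have [w' ww' hw'] := hpar wr.
have w'lt x : h w' < h x -> w' < x by move=> ?; apply: IH => //; nlia.
have uw' : ~~ e w' u by apply/negP => /hlip; nlia.
have nuw' : w' != u by apply: contraTneq lwu => <-; nlia.
have hnu t : e u t -> h w <= h t by rewrite esym => /hlip; nlia.
have key t : e u t -> t != w -> ~~ e w t ->
    forall x y, x \in [:: w'; u] -> y \in [:: w; t] ->
    ~~ connect (del (del e w' w) u t) x y.
  move=> ut tw nwt; apply: opt => //; rewrite 1?esym // 1?eq_sym //.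
  by apply: w'lt; have := hnu _ ut; nlia.
(* Descending steps other than the one from [w] to [w']. Only [w] loses a parent edge, so every
   vertex descends to [r] or to [w]. *)
pose dn := [rel x y | [&& e x y, h y < h x & ~~ ((x == w) && (y == w'))]].
have dnD x : connect dn x r \/ connect dn x w.
  have [k] := ubnP (h x); elim: k x => // k IHk x lk.
  have [->|xw] := eqVneq x w; first by right; apply: connect0.
  have [->|xr] := eqVneq x r; first by left; apply: connect0.
  have [y xy hy] := hpar xr.
  have dxy : connect dn x y by apply: connect1; rewrite /= xy (negPf xw) /=; nlia.
  by case: (IHk y); [nlia| |] => H; [left|right]; apply: connect_trans dxy H.
have dn_level x y : connect dn x y -> x = y \/ h y < h x.
  apply: (connect_ind (P := fun y => x = y \/ h y < h x)); first by left.
  by move=> {}y z [<-|lt] /and3P[_ lt2 _]; right; nlia.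
(* A descent that starts below the level of [u] never meets [u], so it does not use the edge
   [ut]. *)
have dn_del t x y : h x < h u -> connect dn x y -> connect (del (del e w' w) u t) x y.
  move=> lx c; pose P z := connect (del (del e w' w) u t) x z /\ h z < h u.
  suff [//] : P y by [].
  apply: (connect_ind (P := P) _ _ c) => {c y}; first by split.
  move=> y z [cy ly] /and3P[yz lzy nw]; split; last by nlia.
  apply: connect_trans cy (connect1 _).
  apply: delI; last 2 first.
  - by move=> yu; move: ly; rewrite yu ltnn.
  - by move=> yt zu; move: lzy; rewrite zu; nlia.
  apply: delI => // [yw zw|yw zw]; first by move: lzy; rewrite yw zw; nlia.
  by move: nw; rewrite yw zw !eqxx.
have cw'r t : connect (del (del e w' w) u t) w' r.
  apply: dn_del; first by nlia.
  case: (dnD w') => // /dn_level[ww|]; last by nlia.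
  by move: (edge_neq ww'); rewrite ww eqxx.
have count : (forall t, e u t -> t != w -> e w t) -> False.
  move=> sub; have := dmono uw; rewrite /dg (cardsD1 w [set y | e u y]) inE.
  set A := _ :\ w.
  have sA : A \subset [set y | e w y].
    by apply/subsetP=> t; rewrite !inE => /andP[tw ut]; apply: sub.
  have w'A : w' \notin A by rewrite !inE (esym u) (negPf uw') andbF.
  have uA : u \notin A by rewrite !inE eirr andbF.
  case: (boolP (e u w)) => uw2.
    have : w' |: (u |: A) \subset [set y | e w y].
      by rewrite !subUset !sub1set !inE ww' esym uw2.
    move/subset_leq_card; rewrite !cardsU1 uA inE negb_or w'A inE nuw'; nlia.
  have : w' |: A \subset [set y | e w y] by rewrite subUset sub1set inE ww'.
  by move/subset_leq_card; rewrite cardsU1 w'A; nlia.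
(* Taking [w] as the parent of [u] whenever the two are adjacent makes [t != w] imply that they are
   not adjacent. *)
have [t [ut hut tw]] : exists t, [/\ e u t, h u = (h t).+1 & e u w -> t = w].
  case: (boolP (e u w)) => uw2.
    by exists w; split=> //; move: uw2; rewrite esym => /hlip; nlia.
  by have [t ut hut] := hpar ur; exists t.
have tu : t != u by rewrite eq_sym edge_neq.
have wnu : w != u by apply: contraTneq lwu => ->; rewrite ltnn.
have utd t' : t' != t -> del (del e w' w) u t' u t.
  move=> t't; apply: delI.
  - apply: delI => //; first by move=> E; move: nuw'; rewrite E eqxx.
    by move=> E; move: wnu; rewrite E eqxx.
  - by move=> _ E; move: t't; rewrite E eqxx.
  - by move=> _ E; move: tu; rewrite E eqxx.
have step t' : e u t' -> t' != w -> t' != t ->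
    connect (del (del e w' w) u t') t w -> e w t'.
  move=> ut' t'w t't c; apply/negPn/negP => nwt'.
  have /negP[] := key _ ut' t'w nwt' u w (mem_snd _ _) (mem_head _ _).
  exact: connect_trans (connect1 (utd _ t't)) c.
exfalso; case: (boolP ((t == w) || e w t)) => [twt|].
  apply: count => t' ut' t'w; have [tt|t't] := eqVneq t' t.
    by move: twt; rewrite -tt (negPf t'w).
  apply: step => //; case/orP: twt => [/eqP->|wt]; first exact: connect0.
  apply: connect1; apply: delI; last 2 first.
  - by move=> E; move: tu; rewrite E eqxx.
  - by move=> _ E; move: wnu; rewrite E eqxx.
  apply: delI; first by rewrite esym.
  - by move=> E _; move: (hnu _ ut); rewrite E; nlia.
  - by move=> E; move: (edge_neq wt); rewrite E eqxx.
rewrite negb_or => /andP[ntw nwt].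
have ctw : connect dn t w.
  case: (dnD t) => // c.
  have /negP[] := key _ ut ntw nwt w' t (mem_head _ _) (mem_snd _ _).
  apply: connect_trans (cw'r t) _; apply: symC; first exact: del2_sym.
  by apply: dn_del c; nlia.
(* The last step [vw] of the descent gives [w] a neighbour besides [w'], so [u] has a second
   neighbour [t'], which [step] makes adjacent to [w]. Then [h u] is at most [h w + 2], while the
   descent from [t] through [v] to [w] forces at least [h w + 3]. *)
have [v ctv /and3P[vw lwv nvw]] := connect_last ctw ntw.
have [t' ut' t't] : exists2 t', e u t' & t' != t.
  apply: dg_gt1_ex; apply: leq_trans (dmono uw).
  rewrite esym in vw; apply: dg_gt1 ww' vw _.
  by apply: contraTneq lwv => <-; nlia.
have wt' : e w t'.
  apply: step => //; last by apply: dn_del ctw; nlia.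
  by apply: contraNneq ntw => E; rewrite tw // -E.
have := hlip wt'; have : h u <= (h t').+1 by apply: hlip; rewrite esym.
move=> l1 l2; case: (dn_level _ _ ctv) => [E|]; last by nlia.
by move: nwt; rewrite E esym vw.
Qed.

Lemma le_level (x y : 'I_n) : x <= y -> h x <= h y.
Proof. by move=> xy; rewrite leqNgt; apply/negP => /level_lt; nlia. Qed.

(** If [z < v], the swap [uv, zw -> uz, vw] is admissible and keeps the graph connected: [u] and [w]
    both reach the root within levels up to [h u], where neither deleted edge lies. *)
Lemma children_ordered (u w v z : 'I_n) : e u v -> ~~ e w v -> e w z -> ~~ e u z ->
  h w = h u -> h v = (h u).+1 -> h z = (h u).+1 -> u < w -> v < z.
Proof.
move=> uv nwv wz nuz hw hv hz uw; case: (ltngtP v z) => // [zv|/val_inj E]; last first.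
  by move: nuz; rewrite -E uv.
have uz : u != z by apply/eqP => E; move: hz; rewrite -E; nlia.
have vw : v != w by apply/eqP => E; move: hw; rewrite -E; nlia.
have := @opt u v z w; rewrite (esym z) (esym v) => /(_ uv wz uw zv nuz nwv uz vw).
move/(_ u w (mem_head _ _) (mem_snd _ _))/negP; case.
have low x : h x <= h u -> connect (del (del e u v) z w) x r.
  move/low_connect; apply: connect_mono => a b /and3P[ab ha hb].
  apply: delI => [|E|_ E]; last 2 first.
  - by move: ha; rewrite E; nlia.
  - by move: hb; rewrite E; nlia.
  apply: delI => // [_ E|E].
  - by move: hb; rewrite E; nlia.
  - by move: ha; rewrite E; nlia.
apply: connect_trans (low u (leqnn _)) _; apply: symC; first exact: del2_sym.
by apply: low; rewrite hw.
Qed.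

(** * The top triangle *)

Ltac absurd_hyps :=
  match goal with
  | H : is_true (?x != ?x) |- _ => by rewrite eqxx in H
  | H : is_true (e ?x ?x) |- _ => by rewrite eirr in H
  | H : is_true (~~ ?b), H' : is_true ?b |- _ => by rewrite H' in H
  | H : is_true (~~ e ?x ?y), H' : is_true (e ?y ?x) |- _ => by rewrite esym H' in H
  end.

Ltac del_edge :=
  repeat (apply: delI => //); let E1 := fresh in let E2 := fresh in
  move=> E1 E2; subst; absurd_hyps.

(** The configuration to be refuted. The last clause does not say which of [p], [q] comes first, so
    their roles can be exchanged; it supplies the order conditions of every swap
    [pb, qd -> pq, bd]. *)
Definition top_pair (p q : 'I_n) : Prop :=
  [/\ e r p, e r q, p != q, ~~ e p q &
    forall x : 'I_n, x != r -> x != p -> x != q -> p < x /\ q < x].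

Lemma top_pairC p q : top_pair p q -> top_pair q p.
Proof.
case=> rp rq pq npq big; split=> //; [by rewrite eq_sym|by rewrite esym|].
by move=> x xr xq xp; have [] := big x xr xp xq.
Qed.

Lemma top_pair_neq p q b : top_pair p q -> e p b -> b != r ->
  [/\ p != r, q != r, b != p & b != q].
Proof.
case=> rp rq pq npq _ pb br; split; first by rewrite eq_sym edge_neq.
- by rewrite eq_sym edge_neq.
- by rewrite eq_sym edge_neq.
- by apply: contraNneq npq => <-.
Qed.

Lemma top_switch p q b d : top_pair p q -> e p b -> b != r -> e q d -> d != r ->
  b != d -> ~~ e b d -> forall x y, x \in [:: p; q] -> y \in [:: b; d] ->
  ~~ connect (del (del e p b) q d) x y.
Proof.
move=> pq pb br qd dr bd nbd.
have [pr qr bp bq] := top_pair_neq pq pb br.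
have [_ _ dq dp] := top_pair_neq (top_pairC pq) qd dr.
case: pq => rp rq npq epq big.
apply: opt => //; first by have [] := big d dr dp dq.
by have [] := big b br bp bq.
Qed.

Lemma top_dg p q b : top_pair p q -> e p b -> b != r -> dg b <= dg p /\ dg b <= dg q.
Proof.
move=> pq pb br; have [pr qr bp bq] := top_pair_neq pq pb br.
by case: pq => _ _ _ _ /(_ b br bp bq) [pb' qb']; split; apply: dmono.
Qed.

Hypothesis r3 : 2 < dg r.

Lemma third_neighbor p q : exists w, [/\ e r w, w != p & w != q].
Proof.
have : 0 < #|[set z | e r z] :\ p :\ q|.
  move: r3; rewrite /dg (cardsD1 p) (cardsD1 q (_ :\ p)).
  by case: (_ \in _); case: (_ \in _) => //=; nlia.
by case/card_gt0P=> z; rewrite !inE => /and3P[zy zx xz]; exists z.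
Qed.

(* With [w] a neighbour of [r] outside [X], the swap [rw, pb -> rb, wp] forces
   [w < b]; then [w] has a neighbour [t] outside [X], and the swap
   [pb, wt -> pw, bt] is an improvement. *)
Lemma closed_piece p q b (X : {set 'I_n}) : top_pair p q -> p \in X -> q \in X ->
  r \notin X -> (forall x y, x \in X -> e x y -> y != r -> y \in X) ->
  (forall x, x \in X -> e r x -> x = p \/ x = q) -> e p b -> b != r ->
  connect [rel x y | [&& del e p b x y, x \in r |: X & y \in r |: X]] b r -> False.
Proof.
move=> pq pX qX rX clX rXpq pb br cbr.
have [pr qr bp bq] := top_pair_neq pq pb br.
case: (pq) => rp rq npq epq big.
have bX : b \in X by apply: clX pb br.
have nrb : ~~ e r b.
  by apply/negP => /rXpq -/(_ bX)[] E; [move: bp|move: bq]; rewrite E eqxx.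
have [w [rw wp wq]] := third_neighbor p q.
have wr : w != r by rewrite eq_sym edge_neq.
have wX : w \notin X.
  by apply/negP => /rXpq -/(_ rw)[] E; [move: wp|move: wq]; rewrite E eqxx.
have nwp : ~~ e w p by apply/negP => wp2; move/negP: wX; apply; apply: clX pX _ wr; rewrite esym.
have wb : w != b by apply: contraNneq wX => ->.
have w_lt_b : w < b.
  case: (ltngtP w b) => // [bw|/val_inj E]; last by rewrite E eqxx in wb.
  have bep : e b p by rewrite esym.
  have rb : r != b by rewrite eq_sym.
  have /negP[] := opt rw bep (root_lt pr) bw nrb nwp rb wp (mem_head _ _) (mem_snd _ _).
  by apply: connect1; del_edge.
have db : 1 < dg b.
  have [z /and3P[/delE[bz _ nzp] _ _] _] := connect_first cbr br.
  apply: dg_gt1 bz (_ : e b p) _; first by rewrite esym.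
  by apply/eqP => E; apply: nzp.
have [t wt tr] := dg_gt1_ex r (leq_trans db (dmono w_lt_b)).
have tX : t \notin X.
  by apply/negP => tX; move/negP: wX; apply; apply: clX tX _ wr; rewrite esym.
have tp : t != p by apply: contraNneq tX => ->.
have tq : t != q by apply: contraNneq tX => ->.
have bt : b != t by apply: contraNneq tX => <-.
have nbt : ~~ e b t by apply/negP => bt2; move/negP: tX; apply; apply: clX bX bt2 tr.
have [pt _] := big t tr tp tq.
have npw : ~~ e p w by rewrite esym.
have pw : p != w by rewrite eq_sym.
have /negP[] := opt pb wt pt w_lt_b npw nbt pw bt (mem_head _ _) (mem_head _ _).
apply: (@connect_trans _ _ r); first by apply: connect1; rewrite esym in rp; del_edge.
apply: symC; first exact: del2_sym.
apply: connect_mono cbr => x y /and3P[dxy].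
rewrite !in_setU1 => xX yX; apply: delI => // E1 E2; subst.
  by move: xX; rewrite (negPf wr) (negPf wX).
by move: yX; rewrite (negPf wr) (negPf wX).
Qed.

(** Otherwise swap [pb, qc -> pq, bc]: the surviving edge [pc] keeps the graph connected. *)
Lemma common_adj p q b c : top_pair p q -> e p c -> e q c -> c != r ->
  e p b -> b != r -> b != c -> e b c.
Proof.
move=> pq pc qc cr pb br bc; apply/negPn/negP => nbc.
have /negP[] := top_switch pq pb br qc cr bc nbc (mem_head _ _) (mem_snd _ _).
case: (pq) => _ _ npq _ _; have [_ _ cp _] := top_pair_neq pq pc cr.
by apply: connect1; del_edge.
Qed.

(** By [common_adj], the neighbours of [c] include [p], [q] and all neighbours of [p] other than [r]
    and [c]. These already number [dg p], which is at least [dg c], so there are no others. *)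
Lemma common_nbrs p q c y : top_pair p q -> e p c -> e q c -> c != r ->
  e c y -> [\/ y = p, y = q | [/\ e p y, y != r & y != c]].
Proof.
move=> pq pc qc cr cy.
have [pr qr cp cq] := top_pair_neq pq pc cr.
case: (pq) => rp rq npq epq _.
pose A := [set z | e p z] :\ r :\ c.
have sA : p |: (q |: A) \subset [set z | e c z].
  rewrite !subUset !sub1set !inE esym pc esym qc; apply/subsetP => z.
  rewrite !inE => /and3P[zc zr pz]; rewrite esym.
  exact: common_adj pq pc qc cr pz zr zc.
have cA : #|p |: (q |: A)| = dg p.
  rewrite !cardsU1 /A !inE (negPf npq) !eirr (negPf epq) !andbF /=.
  rewrite /dg (cardsD1 r [set y | e p y]) (cardsD1 c (_ :\ r)) !inE cr pc.
  by rewrite (esym p) rp.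
have : p |: (q |: A) == [set z | e c z].
  by rewrite eqEcard sA cA; have [] := top_dg pq pc cr.
move/eqP/setP/(_ y); rewrite !inE cy => /or3P[/eqP->|/eqP->|/and3P[]]; first by constructor 1.
  by constructor 2.
by constructor 3.
Qed.

(** Apart from [r], the vertices [p] and [q] would have the same neighbours. Together with [p] and
    [q] these form a closed piece, in which [c, q, r] is a path avoiding [pc]. *)
Lemma no_common_neighbor p q c : top_pair p q -> e p c -> e q c -> c != r -> False.
Proof.
move=> pq pc qc cr; have qp := top_pairC pq.
have [pr qr cp cq] := top_pair_neq pq pc cr.
have sub u v b : top_pair u v -> e u c -> e v c -> e u b -> b != r -> e v b.
  move=> uv uc vc ub br; have [->//|bc] := eqVneq b c.
  have bec := common_adj uv uc vc cr ub br bc.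
  have [_ _ bu bv] := top_pair_neq uv ub br.
  rewrite esym in bec.
  case: (common_nbrs (top_pairC uv) vc uc cr bec) => [E|E|[]//].
    by rewrite E eqxx in bv.
  by rewrite E eqxx in bu.
case: (pq) => rp rq npq epq _.
apply: (@closed_piece p q c (p |: (q |: [set x | e p x & x != r])) pq) => //.
- by rewrite !inE eqxx.
- by rewrite !inE eqxx orbT.
- by rewrite !inE eqxx (eq_sym r p) (negPf pr) (eq_sym r q) (negPf qr) andbF.
- move=> x y; rewrite !inE => /or3P[/eqP->|/eqP->|/andP[px xr]] exy yr.
  + by rewrite exy yr !orbT.
  + by rewrite (sub q p y) // yr !orbT.
  have qx := sub p q x pq pc qc px xr.
  by case: (common_nbrs pq px qx xr exy) => [->|->|[-> -> _]]; rewrite ?eqxx ?orbT.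
- move=> x; rewrite !inE => /or3P[/eqP->|/eqP->|/andP[px xr]]; [by left|by right|].
  have qx := sub p q x pq pc qc px xr; rewrite esym => xer.
  by case: (common_nbrs pq px qx xr xer) => [E|E|[_ ? _]]; subst; absurd_hyps.
apply: (@connect_trans _ _ q); apply: connect1; rewrite /= !in_setU1 !inE ?eqxx ?pc ?cr ?orbT ?andbT.
  by rewrite esym in qc; del_edge.
by rewrite esym in rq; del_edge.
Qed.

(** Otherwise swap [pb', qd -> pq, b'd]: the path [p, b, d] survives. *)
Lemma cross_adj p q b d b' : top_pair p q -> e p b -> b != r -> e q d -> d != r ->
  e b d -> e p b' -> b' != r -> e b' d.
Proof.
move=> pq pb br qd dr bd pb' b'r; have [->//|b'b] := eqVneq b' b.
apply/negPn/negP => nb'd.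
have b'd : b' != d.
  by apply/eqP => E; subst; apply: no_common_neighbor pq pb' qd dr.
have /negP[] := top_switch pq pb' b'r qd dr b'd nb'd (mem_head _ _) (mem_snd _ _).
case: (pq) => _ _ npq _ _; have [_ _ bp bq] := top_pair_neq pq pb br.
have [_ _ dq dp] := top_pair_neq (top_pairC pq) qd dr.
by apply: (@connect_trans _ _ b); apply: connect1; del_edge.
Qed.

(** The same count: [q] and the neighbours of [p] other than [r] are [dg p] neighbours of [d], and
    [dg d] is at most [dg p]. *)
Lemma cross_nbrs p q b d y : top_pair p q -> e p b -> b != r -> e q d -> d != r ->
  e b d -> e d y -> y = q \/ e p y /\ y != r.
Proof.
move=> pq pb br qd dr bd dy.
have [_ _ dq dp] := top_pair_neq (top_pairC pq) qd dr.
case: (pq) => rp rq npq epq big.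
have sA : q |: ([set z | e p z] :\ r) \subset [set z | e d z].
  rewrite !subUset !sub1set !inE esym qd; apply/subsetP => z.
  rewrite !inE => /andP[zr pz]; rewrite esym.
  exact: cross_adj pq pb br qd dr bd pz zr.
have cA : #|q |: ([set z | e p z] :\ r)| = dg p.
  by rewrite cardsU1 !inE (negPf epq) andbF /dg (cardsD1 r [set y | e p y]) inE esym rp.
have : q |: ([set z | e p z] :\ r) == [set z | e d z].
  by rewrite eqEcard sA cA; have [pd _] := big d dr dp dq; apply: dmono.
by move/eqP/setP/(_ y); rewrite !inE dy => /orP[/eqP->|/andP[]]; [left|right].
Qed.

(** Apart from [r], the neighbourhoods of [p] and [q] would be completely joined to each other and
    have no further edges except to [p] and [q]. This is a closed piece with the path
    [b, d, q, r]. *)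
Lemma no_cross_edge p q b d : top_pair p q -> e p b -> b != r -> e q d -> d != r ->
  e b d -> False.
Proof.
move=> pq pb br qd dr bd; have qp := top_pairC pq.
have db : e d b by rewrite esym.
have [pr qr bp bq] := top_pair_neq pq pb br.
have [_ _ dq dp] := top_pair_neq qp qd dr.
case: (pq) => rp rq npq epq _.
apply: (@closed_piece p q b
  (p |: (q |: [set x | (e p x || e q x) && (x != r)])) pq) => //.
- by rewrite !inE eqxx.
- by rewrite !inE eqxx orbT.
- by rewrite !inE eqxx (eq_sym r p) (negPf pr) (eq_sym r q) (negPf qr) andbF.
- move=> x y; rewrite !inE => /or3P[/eqP->|/eqP->|/andP[/orP[px|qx] xr]] exy yr.
  + by rewrite exy yr !orbT.
  + by rewrite exy yr !orbT.
  + have xd := cross_adj pq pb br qd dr bd px xr; rewrite esym in xd.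
    by case: (cross_nbrs qp qd dr px xr xd exy) => [->|[-> ->]]; rewrite ?eqxx ?orbT.
  have xb := cross_adj qp qd dr pb br db qx xr; rewrite esym in xb.
  by case: (cross_nbrs pq pb br qx xr xb exy) => [->|[-> ->]]; rewrite ?eqxx ?orbT.
- move=> x; rewrite !inE => /or3P[/eqP->|/eqP->|/andP[/orP[px|qx] xr]]; [by left|by right| |].
  + have xd := cross_adj pq pb br qd dr bd px xr; rewrite esym in xd; rewrite esym => xer.
    by case: (cross_nbrs qp qd dr px xr xd xer) => [E|[_ ?]]; subst; absurd_hyps.
  have xb := cross_adj qp qd dr pb br db qx xr; rewrite esym in xb; rewrite esym => xer.
  by case: (cross_nbrs pq pb br qx xr xb xer) => [E|[_ ?]]; subst; absurd_hyps.
apply: (@connect_trans _ _ d); last apply: (@connect_trans _ _ q); apply: connect1;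
  rewrite /= !in_setU1 !inE ?eqxx ?pb ?qd ?br ?dr ?orbT ?andbT.
- by del_edge.
- by rewrite esym in qd; del_edge.
- by rewrite esym in rq; del_edge.
Qed.

(** If [pb] lies on a cycle, let [Y] be the component of [b] after deleting [pb] and [qd].
    Optimality keeps [p] and [q] out of [Y], so the cycle has to pass through [d], and [Y] with [p]
    and [q] becomes a closed piece. *)
Lemma top_edge_bridge p q b : top_pair p q -> 1 < dg q -> e p b -> b != r ->
  ~~ connect (del e p b) b p.
Proof.
move=> pq dq2 pb br; apply/negP => cbp; have qp := top_pairC pq.
have [pr qr bp bq] := top_pair_neq pq pb br.
case: (pq) => rp rq npq epq _.
have [d qd dr] := dg_gt1_ex r dq2.
have [_ _ dq dp] := top_pair_neq qp qd dr.
have neq b' d' : e p b' -> b' != r -> e q d' -> d' != r -> b' != d' /\ ~~ e b' d'.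
  move=> pb' b'r qd' d'r; split.
    by apply/eqP => E; subst; apply: no_common_neighbor pq pb' qd' d'r.
  by apply/negP; apply: no_cross_edge pq pb' b'r qd' d'r.
have sw b' d' : e p b' -> b' != r -> e q d' -> d' != r ->
    forall x y, x \in [:: p; q] -> y \in [:: b'; d'] ->
    ~~ connect (del (del e p b') q d') x y.
  by move=> pb' b'r qd' d'r; have [] := neq _ _ pb' b'r qd' d'r; apply: top_switch.
have [bd nbd] := neq _ _ pb br qd dr.
pose Y := [set z | connect (del (del e p b) q d) b z].
have Ystep z z' : z \in Y -> del (del e p b) q d z z' -> z' \in Y.
  by rewrite !inE => cz /connect1; apply: connect_trans.
have bY : b \in Y by rewrite inE connect0.
have pqY z : z \in [:: p; q] -> z \notin Y.
  move=> zpq; rewrite inE; apply/negP => c.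
  have /negP[] := sw b d pb br qd dr z b zpq (mem_head _ _).
  by apply: symC c; exact: del2_sym.
have pY := pqY p (mem_head _ _); have qY := pqY q (mem_snd _ _).
have rY : r \notin Y.
  by apply: contra pY => rY; apply: Ystep rY _; del_edge.
have dY : d \in Y.
  apply/negPn/negP => dY; move/negP: pY; apply.
  apply: (connect_ind (P := fun z => z \in Y) _ _ cbp) => // z z' zY zz'.
  by apply: Ystep (zY) _; del_edge.
have cY : connect [rel z z' | [&& e z z', z \in Y & z' \in Y]] b d.
  pose P z := z \in Y /\ connect [rel z z' | [&& e z z', z \in Y & z' \in Y]] b z.
  suff [//] : P d by [].
  have cbd : connect (del (del e p b) q d) b d by move: dY; rewrite inE.
  apply: (connect_ind (P := P) _ _ cbd) => [|z z' [zY cz] zz']; first by split.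
  have z'Y := Ystep _ _ zY zz'; split=> //; apply: connect_trans cz (connect1 _).
  by case/delE: zz' => /delE[ezz' _ _] _ _; rewrite /= ezz' zY.
have cYdel b' d' : connect (del (del e p b') q d') b d.
  apply: connect_mono cY => z z' /and3P[ezz' zY z'Y]; by del_edge.
(* With another neighbour [d'] in place of [d] in the swap, the walk from [b] to [d] inside [Y],
   followed by the edge [dq], would survive. *)
have uniqd d' : e q d' -> d' != r -> d' = d.
  move=> qd' d'r; apply/eqP/negPn/negP => d'd.
  have /negP[] := sw b d' pb br qd' d'r q b (mem_snd _ _) (mem_head _ _).
  apply: symC; first exact: del2_sym.
  apply: connect_trans (cYdel b d') (connect1 _).
  by have dq' : e d q; [rewrite esym | del_edge].
have uniqb b' : e p b' -> b' != r -> b' = b.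
  move=> pb' b'r; apply/eqP/negPn/negP => b'b.
  have /negP[] := sw b' d pb' b'r qd dr p d (mem_head _ _) (mem_snd _ _).
  by apply: connect_trans (connect1 _) (cYdel b' d); del_edge.
apply: (@closed_piece p q b (p |: (q |: Y)) pq) => //.
- by rewrite !in_setU1 eqxx.
- by rewrite !in_setU1 eqxx orbT.
- by rewrite !in_setU1 (negPf rY) (eq_sym r p) (negPf pr) (eq_sym r q) (negPf qr).
- move=> x y; rewrite !in_setU1 => /or3P[/eqP->|/eqP->|xY] exy yr.
  + by rewrite (uniqb y) // bY !orbT.
  + by rewrite (uniqd y) // dY !orbT.
  have [//|yp] := eqVneq y p; have [//|yq] := eqVneq y q.
  by apply: Ystep (xY) _; del_edge.
- move=> x; rewrite !in_setU1 => /or3P[/eqP->|/eqP->|xY]; [by left|by right|].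
  rewrite esym => xr; have rY' : r \in Y by apply: Ystep (xY) _; del_edge.
  by absurd_hyps.
apply: (@connect_trans _ _ d); last apply: (@connect_trans _ _ q).
- apply: connect_mono cY => z z' /and3P[ezz' zY z'Y].
  by rewrite /= !in_setU1 zY z'Y !orbT !andbT; del_edge.
- apply: connect1; rewrite /= !in_setU1 eqxx dY !orbT !andbT.
  by have dq' : e d q; [rewrite esym | del_edge].
- apply: connect1; rewrite /= !in_setU1 !eqxx !orbT !andbT.
  by rewrite esym in rq; del_edge.
Qed.

(** * Cycles away from the top pair, and branches behind bridges *)

Definition on_level_cycle x := exists y1 y2,
  [/\ y1 != y2, e x y1 /\ e x y2, h y1 <= h x & h y2 <= h x].

(** Both neighbours reach the root without meeting [x], so [x] is joined to [y1] through [y2]. *)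
Lemma level_cycle_edge x y1 y2 : y1 != y2 -> e x y1 -> e x y2 ->
  h y1 <= h x -> h y2 <= h x -> connect (del e x y1) x y1.
Proof.
move=> y12 xy1 xy2 h1 h2.
have y1x : y1 != x by rewrite eq_sym edge_neq.
have y2x : y2 != x by rewrite eq_sym edge_neq.
have low y : h y <= h x -> y != x -> connect (del e x y1) y r.
  move=> hy yx; apply: connect_mono (avoid_connect hy yx) => a b /and3P[ab ax bx].
  by del_edge.
apply: (@connect_trans _ _ y2).
  by apply: connect1; del_edge.
apply: connect_trans (low y2 h2 y2x) (symC _ (low y1 h1 y1x)).
exact: del_sym.
Qed.

Definition far_cycle_edge (p q x y : 'I_n) : Prop :=
  [/\ e x y, connect (del e x y) x y, [/\ x != r, x != p & x != q],
      [/\ y != r, y != p & y != q] & ~~ e p x /\ ~~ e p y].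

(** Edges at [p] or [q] that do not lead to [r] are bridges, while the edges from [x] to [y1] and
    [y2] lie on cycles. Hence [x] is neither [p] nor [q] nor adjacent to them, and one of [y1], [y2]
    is a suitable [y]. *)
Lemma far_cycle_edge_ex p q x : top_pair p q -> 1 < dg p -> 1 < dg q ->
  on_level_cycle x -> exists y, far_cycle_edge p q x y.
Proof.
move=> pq dp2 dq2 [y1 [y2 [y12 [xy1 xy2] h1 h2]]].
have qp := top_pairC pq; case: (pq) => rp rq npq epq _.
have pr : p != r by rewrite eq_sym edge_neq.
have bridge b := @top_edge_bridge p q b pq dq2.
have bridgeq b := @top_edge_bridge q p b qp dp2.
have c1 := level_cycle_edge y12 xy1 xy2 h1 h2.
have y21 : y2 != y1 by rewrite eq_sym.
have c2 := level_cycle_edge y21 xy2 xy1 h2 h1.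
have xr : x != r.
  apply: contraNneq y12 => E; rewrite E h0 !leqn0 in h1 h2.
  by rewrite (h_eq0 (eqP h1)) (h_eq0 (eqP h2)).
have nx u : (forall b, e u b -> b != r -> ~~ connect (del e u b) b u) -> x != u.
  move=> br; apply/eqP => E; subst u.
  have [E|y1r] := eqVneq y1 r; last first.
    by move/negP: (br y1 xy1 y1r); apply; apply: symC c1; apply: del_sym.
  have y2r : y2 != r by rewrite -E.
  by move/negP: (br y2 xy2 y2r); apply; apply: symC c2; apply: del_sym.
have xp := nx p bridge; have xq := nx q bridgeq.
have nux u : e r u -> (forall b, e u b -> b != r -> ~~ connect (del e u b) b u) ->
    x != u -> ~~ e u x.
  move=> ru br xu; apply/negP => ux; move/negP: (br x ux xr); apply.
  have ur : u != r by rewrite eq_sym edge_neq.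
  have [y [xy yu hy]] : exists y, [/\ e x y, y != u & h y <= h x].
    have [E|y1u] := eqVneq y1 u; last by exists y1.
    by exists y2; split=> //; rewrite -E.
  have yx : y != x by rewrite eq_sym edge_neq.
  apply: (@connect_trans _ _ y); first by apply: connect1; del_edge.
  apply: (@connect_trans _ _ r); last by apply: connect1; del_edge.
  by apply: connect_mono (avoid_connect hy yx) => a b /and3P[ab ax bx]; del_edge.
have npx := nux p rp bridge xp; have nqx := nux q rq bridgeq xq.
have ny u y : e x y -> ~~ e u x -> y != u.
  by move=> xy nu; apply: contraNneq nu => <-; rewrite esym.
have good y : e x y -> connect (del e x y) x y -> y != r -> ~~ e p y ->
    exists y, far_cycle_edge p q x y.
  move=> xy cy yr npy; exists y; split=> //.
  by split=> //; [apply: ny xy npx|apply: ny xy nqx].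
(* Such a [y] is a child of [r], so the path [y, r, p] bypasses the bridge [py]. *)
have far y : e p y -> y != r -> h y <= h x -> h x <= 1 -> False.
  move=> py yr hy hx; have [z yz hz] := hpar yr.
  have zr : z = r by apply: h_eq0; nlia.
  subst z; move/negP: (bridge y py yr); apply.
  by apply: (@connect_trans _ _ r); apply: connect1; del_edge.
have hx1 y : e x y -> y = r -> h x <= 1.
  by move=> xy E; rewrite -h0 -E; apply: hlip; rewrite esym.
case: (eqVneq y1 r) => [E1|y1r].
  have y2r : y2 != r by rewrite -E1.
  case: (boolP (e p y2)) => [py2|]; last by apply: (good y2).
  by case: (far y2 py2 y2r h2 (hx1 _ xy1 E1)).
case: (boolP (e p y1)) => [py1|]; last by apply: (good y1).
case: (eqVneq y2 r) => [E2|y2r].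
  by case: (far y1 py1 y1r h1 (hx1 _ xy2 E2)).
case: (boolP (e p y2)) => [py2|]; last by apply: (good y2).
(* Both [y1] and [y2] are adjacent to [p], so the path [y1, x, y2, p] bypasses the bridge between
   [p] and [y1]. *)
have /negP[] := bridge y1 py1 y1r.
have y1p := ny p y1 xy1 npx; have y2p := ny p y2 xy2 npx.
apply: (@connect_trans _ _ x); first by rewrite esym in xy1; apply: connect1; del_edge.
apply: (@connect_trans _ _ y2); first by apply: connect1; del_edge.
by rewrite esym in py2; apply: connect1; del_edge.
Qed.

Definition branch p b := [set z | connect (del e p b) b z].

Lemma branch_root p b : b \in branch p b.
Proof. by rewrite inE connect0. Qed.

Lemma branch_step p b z z' : z \in branch p b -> del e p b z z' -> z' \in branch p b.
Proof. by rewrite !inE => cz /connect1; apply: connect_trans. Qed.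

Lemma branch_top p q b : top_pair p q -> 1 < dg q -> e p b -> b != r ->
  [/\ p \notin branch p b, r \notin branch p b & q \notin branch p b].
Proof.
move=> pq dq2 pb br; have [pr qr bp bq] := top_pair_neq pq pb br.
case: (pq) => rp rq npq epq _.
have pS : p \notin branch p b by rewrite inE (top_edge_bridge pq).
have rS : r \notin branch p b.
  by apply: contra pS => rS; apply: branch_step rS _; del_edge.
split=> //; apply: contra rS => qS; apply: branch_step qS _.
by rewrite esym in rq; del_edge.
Qed.

Lemma branch_exit p b z z' : p \notin branch p b -> z \in branch p b -> e z z' ->
  z' \notin branch p b -> z = b /\ z' = p.
Proof.
move=> pS zS zz' z'S; have [zb|zb] := eqVneq z b; have [z'p|z'p] := eqVneq z' p => //.
all: exfalso; move/negP: z'S; apply; apply: branch_step (zS) _; apply: delI => //.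
all: move=> E1 E2; subst; absurd_hyps.
Qed.

(* A closed walk that enters the branch must leave it through the bridge [pb], so
   collapsing the branch onto [p] yields a walk that avoids it. *)
Lemma branch_avoid p b x y : p \notin branch p b -> x \notin branch p b ->
  y \notin branch p b -> connect (del e x y) x y ->
  connect [rel z z' | [&& del e x y z z', z \notin branch p b & z' \notin branch p b]] x y.
Proof.
move=> pS xS yS c; set R := [rel z z' | _].
pose phi z := if z \in branch p b then p else z.
have <- : phi x = x by rewrite /phi (negPf xS).
have <- : phi y = y by rewrite /phi (negPf yS).
apply: connect_hom c => z z' zz'; have [ezz' _ _] := delE zz'; rewrite /phi.
case: (boolP (z \in branch p b)) => zS; case: (boolP (z' \in branch p b)) => z'S.
- exact: connect0.
- by have [_ ->] := branch_exit pS zS ezz' z'S; apply: connect0.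
- by rewrite esym in ezz'; have [_ ->] := branch_exit pS z'S ezz' zS; apply: connect0.
- by apply: connect1; rewrite /R /= zS z'S zz'.
Qed.

Lemma far_cycle_edgeC p q x y : far_cycle_edge p q x y -> far_cycle_edge p q y x.
Proof.
case=> xy c nx ny [px py]; split=> //; first by rewrite esym.
rewrite (eq_connect (delC e y x)); apply: symC c; exact: del_sym.
Qed.

(** Induction along the branch, starting with [u = p] and [g = b]. If [u < y] but the neighbour [g]
    of [u] did not precede [x], the swap [ug, xy -> ux, gy] would be admissible, and the rest of a
    cycle through [xy] that avoids the branch would survive. The bound on one end of [xy] yields the
    next bound on the other, so both are carried along. *)
Lemma branch_lt (p q b x y z : 'I_n) : top_pair p q -> 1 < dg q -> e p b -> b != r ->
  far_cycle_edge p q x y -> x \notin branch p b -> z \in branch p b -> z < x.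
Proof.
move=> pq dq2 pb br far xS zS.
have [pS rS qS] := branch_top pq dq2 pb br.
case: (pq) => rp rq npq epq big.
have half (x' y' u g : 'I_n) : far_cycle_edge p q x' y' -> x' \notin branch p b ->
    y' \notin branch p b -> u < y' -> ~~ e u x' -> u != x' -> g \in branch p b ->
    e u g -> g < x'.
  move=> [xy c [xr xp xq] [yr yp yq] _] x'S y'S uy nux ux gS ug.
  case: (ltngtP g x') => // [xg|/val_inj E]; last by rewrite -E gS in x'S.
  have ngy : ~~ e g y'.
    apply/negP => gy; have [_ E] := branch_exit pS gS gy y'S.
    by rewrite E eqxx in yp.
  have gy : g != y' by apply: contraNneq y'S => <-.
  have /negP[] := opt ug xy uy xg nux ngy ux gy (mem_snd _ _) (mem_snd _ _).
  apply: connect_mono (branch_avoid pS x'S y'S c) => a a' /and3P[/delE[aa n1 n2] aS a'S].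
  apply: delI => //; by del_edge.
have yS : y \notin branch p b.
  case: far => xy _ [_ xp _] [_ yp _] _; apply: contra xS => yS.
  by rewrite esym in xy; apply: branch_step yS _; del_edge.
have far' := far_cycle_edgeC far.
have all_half (x' y' : 'I_n) : far_cycle_edge p q x' y' -> x' \notin branch p b ->
    y' \notin branch p b -> b < x'.
  move=> f x'S y'S; case: (f) => xy c [xr xp xq] [yr yp yq] [px py].
  have [py' _] := big y' yr yp yq.
  by apply: half f x'S y'S py' px _ (branch_root _ _) pb; rewrite eq_sym.
have neb u v : u \in branch p b -> v \notin branch p b -> v != p -> ~~ e u v /\ u != v.
  move=> uS vS vp; split; last by apply: contraNneq vS => <-.
  by apply/negP => uv; have [_ E] := branch_exit pS uS uv vS; rewrite E eqxx in vp.
have xp : x != p by case: far => _ _ [].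
have yp : y != p by case: far => _ _ _ [].
pose P (u : 'I_n) := [/\ u \in branch p b, u < x & u < y].
suff [] : P z by [].
have c : connect (del e p b) b z by move: zS; rewrite inE.
apply: (connect_ind (P := P) _ _ c) => [|u v [uS ux uy] uv].
  by split; [exact: branch_root|apply: all_half far xS yS|apply: all_half far' yS xS].
have vS := branch_step uS uv; case/delE: uv => uv _ _.
have [nux nx] := neb u x uS xS xp; have [nuy ny] := neb u y uS yS yp.
split=> //; first exact: half far xS yS uy nux nx vS uv.
exact: half far' yS xS ux nuy ny vS uv.
Qed.

(* Take a vertex of the branch farthest from [r]: it has a second neighbour because
   it precedes [x], and no neighbour of it is farther away. *)
Lemma branch_level_cycle (p q b x : 'I_n) : top_pair p q -> 1 < dg q -> e p b -> b != r ->
  1 < dg x -> (forall z : 'I_n, z \in branch p b -> z < x) ->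
  exists2 z, z \in branch p b & on_level_cycle z.
Proof.
move=> pq dq2 pb br dx Sx.
have [pS rS qS] := branch_top pq dq2 pb br.
have [z zS zmax] := @arg_maxnP _ b (mem (branch p b)) h (branch_root p b).
exists z => //; have zr : z != r by apply: contraNneq rS => <-.
have [y1 zy1 hz] := hpar zr.
have [y2 zy2 y21] := dg_gt1_ex y1 (leq_trans dx (dmono (Sx z zS))).
exists y1, y2; split=> //; first by rewrite eq_sym.
  by rewrite hz.
case: (boolP (y2 \in branch p b)) => [/zmax//|y2S].
have [-> ->] := branch_exit pS zS zy2 y2S.
case: (pq) => rp _ _ _ _; have := hlip rp; rewrite h0 => /leq_trans; apply.
by rewrite lt0n; apply: contraNneq br => /h_eq0->.
Qed.

(** A walk from [z] to [d] inside [branch q d] never meets [p], so it cannot leave [branch p b];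
    then [d], and with it [q], would lie in [branch p b]. *)
Lemma branch_disjoint p q b d z : top_pair p q -> 1 < dg p -> 1 < dg q ->
  e p b -> b != r -> e q d -> d != r -> z \in branch p b -> z \notin branch q d.
Proof.
move=> pq dp2 dq2 pb br qd dr zS; have qp := top_pairC pq.
have [pS rS qS] := branch_top pq dq2 pb br.
have [qS' rS' pS'] := branch_top qp dp2 qd dr.
have [_ _ dq dp] := top_pair_neq qp qd dr.
case: (pq) => _ _ npq _ _.
apply: contra qS => zS'.
suff dS : d \in branch p b.
  by rewrite esym in qd; apply: branch_step dS _; del_edge.
have c : connect (del e q d) z d.
  by move: zS'; rewrite inE => c; apply: symC c; apply: del_sym.
pose P u := u \in branch p b /\ u \in branch q d.
suff [] : P d by [].
apply: (connect_ind (P := P) _ _ c) => // u v [uS uS'] uv.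
have vS' := branch_step uS' uv; split=> //; case/delE: uv => uv _ _.
by apply: branch_step (uS) _; del_edge.
Qed.

(** The branch at [p] precedes [x], so it has a level cycle at some [z]. The branch at [q] then
    precedes [z], so it has one at some [t]. Now the branch at [p] precedes [t], and [t < z < t]. *)
Lemma no_outside_cycle p q b d x : top_pair p q -> 1 < dg p -> 1 < dg q ->
  e p b -> b != r -> e q d -> d != r -> on_level_cycle x -> x \notin branch p b -> False.
Proof.
move=> pq dp2 dq2 pb br qd dr cx xS; have qp := top_pairC pq.
have dg2 y : on_level_cycle y -> 1 < dg y.
  by case=> y1 [y2 [y12 [yy1 yy2] _ _]]; apply: dg_gt1 yy1 yy2 y12.
have [y fxy] := far_cycle_edge_ex pq dp2 dq2 cx.
have Sx (z : 'I_n) : z \in branch p b -> z < x by apply: branch_lt pq dq2 pb br fxy xS.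
have [z zS cz] := branch_level_cycle pq dq2 pb br (dg2 _ cx) Sx.
have zS' := branch_disjoint pq dp2 dq2 pb br qd dr zS.
have [y' fzy] := far_cycle_edge_ex qp dq2 dp2 cz.
have Sz (t : 'I_n) : t \in branch q d -> t < z by apply: branch_lt qp dp2 qd dr fzy zS'.
have [t tS ct] := branch_level_cycle qp dp2 qd dr (dg2 _ cz) Sz.
have tS' := branch_disjoint qp dq2 dp2 qd dr pb br tS.
have [y'' fty] := far_cycle_edge_ex pq dp2 dq2 ct.
have := branch_lt pq dq2 pb br fty tS' zS; have := Sz t tS; nlia.
Qed.

Lemma no_top_pair p q x : top_pair p q -> 1 < dg p -> 1 < dg q ->
  on_level_cycle x -> False.
Proof.
move=> pq dp2 dq2 cx; have qp := top_pairC pq.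
have [b pb br] := dg_gt1_ex r dp2; have [d qd dr] := dg_gt1_ex r dq2.
case: (boolP (x \in branch p b)) => [xS|]; last exact: no_outside_cycle pq dp2 dq2 pb br qd dr cx.
have xS' := branch_disjoint pq dp2 dq2 pb br qd dr xS.
exact: no_outside_cycle qp dq2 dp2 qd dr pb br cx xS'.
Qed.

Lemma triangle_of_cycle (p q x : 'I_n) : nat_of_ord p = 1 -> nat_of_ord q = 2 ->
  on_level_cycle x -> [/\ e r p, e p q & e r q].
Proof.
move=> p1 q2 cx.
have [w [rw wp wq]] := third_neighbor p q.
have wr : w != r by rewrite eq_sym edge_neq.
have w3 : 2 < w.
  by move: wp wq wr; rewrite -!val_eqE /= p1 q2 r0; case: (nat_of_ord w) => [|[|[|]]].
(* The third neighbour [w] of [r] has label at least 3 and level at most 1, so by [level_lt] no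
   smaller label lies on a higher level. *)
have root_nbr (u : 'I_n) : 0 < u <= 2 -> e r u.
  move=> /andP[u0 u2].
  have ur : u != r by rewrite -val_eqE /= r0 -lt0n.
  have hu : h u <= 1.
    rewrite leqNgt; apply/negP => h1; have := @level_lt w u.
    by have := hlip rw; rewrite h0 => hw /(_ (leq_ltn_trans hw h1)); nlia.
  have [y uy hy] := hpar ur; rewrite esym.
  by have <- : y = r by apply: h_eq0; nlia.
have rp : e r p by apply: root_nbr; rewrite p1.
have rq : e r q by apply: root_nbr; rewrite q2.
split=> //; apply/negPn/negP => npq.
have tp : top_pair p q.
  split=> //; first by rewrite -val_eqE /= p1 q2.
  by move=> y; rewrite -!val_eqE /= r0 p1 q2; case: (nat_of_ord y) => [|[|[|]]].
have qmono (y : 'I_n) : 1 < y -> dg y <= dg q.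
  rewrite leq_eqVlt => /orP[/eqP E|y2]; last by apply: dmono; rewrite q2.
  by have -> : y = q by apply: val_inj; rewrite /= q2 E.
(* The distinct vertices [x], [y1], [y2] all have degree at least 2, and one of them has label at
   least 2, hence degree at most that of [q]. *)
have dq2 : 1 < dg q.
  case: (cx) => y1 [y2 [y12 [xy1 xy2] h1 h2]].
  have y21 : y2 != y1 by rewrite eq_sym.
  have dy y y' : y != y' -> e x y -> e x y' -> h y <= h x -> h y' <= h x -> 1 < dg y.
    move=> yy' xy xy' hy hy'; have yx : y != x by rewrite eq_sym edge_neq.
    have c := symC (del_sym x y esym) (level_cycle_edge yy' xy xy' hy hy').
    have [z /delE[yz _ nz] _] := connect_first c yx.
    apply: dg_gt1 yz (_ : e y x) _; first by rewrite esym.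
    by apply/eqP => E; apply: nz.
  have [x2|x2] := ltnP 1 x; first exact: leq_trans (dg_gt1 xy1 xy2 y12) (qmono _ x2).
  have [l1|l1] := ltnP 1 y1; first exact: leq_trans (dy _ _ y12 xy1 xy2 h1 h2) (qmono _ l1).
  have [l2|l2] := ltnP 1 y2; first exact: leq_trans (dy _ _ y21 xy2 xy1 h2 h1) (qmono _ l2).
  have := edge_neq xy1; have := edge_neq xy2; move: y12; rewrite -!val_eqE /=.
  by move: x2 l1 l2; case: (nat_of_ord x) => [|[|]] // _; case: (nat_of_ord y1) => [|[|]] // _;
    case: (nat_of_ord y2) => [|[|]].
by apply: (no_top_pair tp _ dq2 cx); apply: leq_trans dq2 (dmono _); rewrite p1 q2.
Qed.

End LocallyOptimal.

(** * Degree sums *)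

Section Handshake.

Variables (n : nat) (e : rel 'I_n).
Hypothesis esym : symmetric e.
Hypothesis eirr : irreflexive e.

Lemma sum_deg_lower :
  \sum_x #|[set y | e x y]| = (\sum_x #|[set y : 'I_n | e x y & y < x]|).*2.
Proof.
have cardE (P : 'I_n -> pred 'I_n) x : #|[set y | P x y]| = \sum_y P x y.
  by rewrite -sum1dep_card big_mkcond; apply: eq_bigr => y _; case: (P x y).
under eq_bigr do rewrite (cardE e).
under [in RHS]eq_bigr => x _ do rewrite (cardE (fun x y : 'I_n => e x y && (y < x))).
rewrite -addnn [X in _ = _ + X]exchange_big /= -big_split /=.
apply: eq_bigr => x _; rewrite -big_split /=; apply: eq_bigr => y _.
rewrite (esym y); case: (boolP (e x y)) => //= exy.
case: ltngtP => // /val_inj E; by rewrite E eirr in exy.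
Qed.

(** Charge each edge to its end with the larger label. There are at least [n] edges and label 0 is
    charged none, so some vertex is charged twice. *)
Lemma two_lower_neighbors (r : 'I_n) : nat_of_ord r = 0 ->
  n.*2 <= \sum_x #|[set y | e x y]| ->
  exists x y1 y2 : 'I_n, [/\ y1 != y2, e x y1 /\ e x y2, y1 < x & y2 < x].
Proof.
move=> r0; rewrite sum_deg_lower leq_double => le_n.
pose L x := [set y : 'I_n | e x y & y < x].
case: (boolP [exists x, 1 < #|L x|]) => [/existsP[x]|].
  case/card_gt1P => y1 [y2 [y1L y2L y12]]; exists x, y1, y2.
  by move: y1L y2L; rewrite !inE => /andP[? ?] /andP[? ?].
rewrite negb_exists => /forallP Lx; exfalso.
have Lr : #|L r| = 0.
  by apply/eqP; rewrite cards_eq0 -subset0; apply/subsetP => y; rewrite inE r0 ltn0 andbF.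
have : \sum_x #|L x| <= \sum_(x | x != r) 1.
  rewrite (bigD1 r) //= Lr add0n; apply: leq_sum => x _.
  by rewrite leqNgt Lx.
have : \sum_(x < n) 1 = n by rewrite sum1_card card_ord.
rewrite (bigD1 r) //= => En le2; move: le_n; rewrite -/L => le_n.
by have := leq_trans le_n le2; rewrite -{1}En ltnn.
Qed.

(** A leaf together with degrees at most 2 elsewhere would make the degree sum less than [n.*2]. *)
Lemma max_deg_gt2 (r l : 'I_n) : nat_of_ord r = 0 ->
  (forall x y : 'I_n, x < y -> #|[set z | e y z]| <= #|[set z | e x z]|) ->
  #|[set z | e l z]| = 1 -> n.*2 <= \sum_x #|[set y | e x y]| ->
  2 < #|[set z | e r z]|.
Proof.
move=> r0 mono l1 le_n; rewrite ltnNge; apply/negP => r2.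
have d2 x : #|[set y | e x y]| <= 2.
  have [->//|xr] := eqVneq x r.
  by apply: leq_trans (mono r x _) r2; rewrite r0 lt0n -r0 (inj_eq val_inj).
have le2 : \sum_(x | x != l) #|[set y | e x y]| <= \sum_(x : 'I_n | x != l) 2.
  by apply: leq_sum => x _; apply: d2.
have : \sum_(x < n) 2 = n.*2 by rewrite sum_nat_const card_ord muln2.
move: le_n; rewrite (bigD1 l) //= l1 (bigD1 l (F := fun=> 2)) //= => le1 E.
by move: (leq_trans le1 (leq_add (leqnn 1) le2)); rewrite -E leq_add2r.
Qed.

End Handshake.

(** * Distances, edge sums and swaps *)

Section Distance.

Variable G : graph.

Lemma has_walkP (u v : G) k :
  reflect (exists p : seq G, [/\ path (@adj G) u p, size p = k & last u p = v])
    (has_walk u v k).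
Proof.
apply: (iffP existsP) => [[p /andP[pp /eqP lp]]|[p [pp sp lp]]].
  by exists p; rewrite size_tuple.
have sp' : size p == k by rewrite sp.
by exists (Tuple sp'); rewrite pp /= lp eqxx.
Qed.

Lemma dist_le (u v : G) k : has_walk u v k -> dist u v <= k.
Proof.
move=> w; rewrite leqNgt; apply/negP => lt.
have kG : k < #|G|.
  by apply: leq_trans lt _; rewrite /dist -{2}(size_iota 0 #|G|) find_size.
by have := before_find 0 lt; rewrite nth_iota // add0n w.
Qed.

Hypothesis cG : connected G.

Lemma has_walk_dist (u v : G) : has_walk u v (dist u v).
Proof.
have hw : has (has_walk u v) (iota 0 #|G|).
  have /connectP[p /shortenP[p' pp' up' _] lp] := cG.2 u v.
  apply/hasP; exists (size p'); last by apply/has_walkP; exists p'.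
  by rewrite mem_iota /= add0n; have := max_card (mem (u :: p')); rewrite (card_uniqP up').
have := nth_find 0 hw; rewrite nth_iota //; rewrite has_find size_iota in hw.
exact: hw.
Qed.

Lemma dist_root (u : G) : dist u u = 0.
Proof. by apply/eqP; rewrite -leqn0; apply: dist_le; apply/has_walkP; exists [::]. Qed.

Lemma dist_lip (u x y : G) : adj x y -> dist u y <= (dist u x).+1.
Proof.
move=> xy; apply: dist_le; apply/has_walkP.
have /has_walkP[p [pp sp lp]] := has_walk_dist u x.
by exists (rcons p y); rewrite rcons_path pp lp xy size_rcons sp last_rcons.
Qed.

Lemma dist_parent (u x : G) : x != u -> exists2 y, adj x y & dist u x = (dist u y).+1.
Proof.
move=> xu; have /has_walkP[p] := has_walk_dist u x.
case/lastP: p => [|p z] [pp sp lp]; first by rewrite /= in lp; rewrite lp eqxx in xu.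
move: pp lp; rewrite rcons_path last_rcons => /andP[pp lz] zx; subst z.
exists (last u p); first by rewrite adj_sym.
apply/eqP; rewrite eqn_leq dist_lip // -sp size_rcons ltnS; apply: dist_le.
by apply/has_walkP; exists p.
Qed.

End Distance.

Section EdgeSums.

Import GRing.Theory Num.Theory.
Local Open Scope ring_scope.

Variable G : graph.

Lemma sum_adj_pairs (V : nmodType) (F : {set G} -> V) :
  \sum_(p : G * G | adj p.1 p.2) F [set p.1; p.2] = (\sum_(E in edges G) F E) *+ 2.
Proof.
rewrite (partition_big (fun p : G * G => [set p.1; p.2]) (mem (edges G))) /=; last first.
  by move=> p pe; apply/imsetP; exists p; rewrite ?inE.
rewrite -sumrMnl; apply: eq_bigr => E /imsetP[[u v]]; rewrite inE /= => uv ->.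
rewrite (eq_bigr (fun=> F [set u; v])) => [|p /andP[_ /eqP->] //].
rewrite sumr_const; congr (_ *+ _).
have nuv : (u, v) != (v, u).
  by apply: contraTneq uv => -[-> _]; rewrite adj_irr.
have <- : #|[set (u, v); (v, u)]| = 2%N by rewrite cards2 nuv.
apply: eq_card => -[x y]; rewrite !inE !xpair_eqE unfold_in /=.
apply/andP/orP => [[xy /eqP/setP Exy]|].
  have := Exy x; have := Exy y; rewrite !inE !eqxx orbT /= => /esym/orP[]/eqP yu /esym/orP[]/eqP xv;
    subst; rewrite ?adj_irr // in xy *; [right|left]; by rewrite !eqxx.
case=> /andP[/eqP-> /eqP->]; first by rewrite eqxx.
by rewrite adj_sym setUC eqxx.
Qed.

Lemma sum_deg_edges : \sum_(u : G) deg u = (#|edges G|.*2)%N.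
Proof.
have <- : \sum_(p : G * G | adj p.1 p.2) 1%N = (#|edges G|.*2)%N.
  rewrite (sum_adj_pairs (fun=> 1%N)) sumr_const -mulrnA muln2; exact: natn.
rewrite -(pair_big_dep predT (fun u v : G => adj u v) (fun _ _ => 1%N)) /=.
apply: eq_bigr => u _; rewrite /deg /nbr -sum1_card.
by apply: eq_bigl => v; rewrite inE.
Qed.

Lemma deg_gt0 (u v : G) : adj u v -> (0 < deg u)%N.
Proof. by move=> uv; apply/card_gt0P; exists v; rewrite inE. Qed.

Variables (R : realType) (f : R -> R -> R).
Hypothesis f_sym : symmetric_on_pos f.

(** For symmetric [f] this is twice [Mf]; summing over ordered pairs makes relabelling and swapping
    direct. *)
Definition pair_sum : R :=
  \sum_(u : G) \sum_(v : G) (adj u v)%:R * f (deg u)%:R (deg v)%:R.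

Lemma edge_valueE (u v : G) : adj u v ->
  edge_value f [set u; v] = f (deg u)%:R (deg v)%:R.
Proof.
move=> uv; have nuv : u != v by apply: contraTneq uv => ->; rewrite adj_irr.
have pe : perm_eq (enum [set u; v]) [:: u; v].
  apply: uniq_perm; rewrite ?enum_uniq //= ?inE ?nuv //.
  by move=> x; rewrite mem_enum !inE.
have vu : adj v u by rewrite adj_sym.
(* The two ends may be listed in either order; [f_sym] absorbs this because both degrees are
   positive. *)
rewrite /edge_value; have := perm_size pe; case: (enum _) pe => [|x [|y [|]]] //= pe _.
have nxy : x != y by have := perm_uniq pe; rewrite /= !inE nuv !andbT.
have := perm_mem pe x; have := perm_mem pe y; rewrite !inE !eqxx orbT /=.
move=> /esym/orP[]/eqP Ey /esym/orP[]/eqP Ex; subst x y; rewrite ?eqxx // in nxy.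
by apply: f_sym; rewrite ltr0n; apply: deg_gt0; eassumption.
Qed.

Lemma pair_sumE : pair_sum = Mf f G *+ 2.
Proof.
rewrite /Mf -sum_adj_pairs /pair_sum pair_bigA /= [in RHS]big_mkcond /=.
apply: eq_bigr => -[u v] _ /=; case: ifP => [/edge_valueE->|_]; first by rewrite mul1r.
by rewrite mul0r.
Qed.

End EdgeSums.

Section Switch.

Import GRing.Theory Num.Theory.

Variables (n : nat) (e : rel 'I_n) (a b c d : 'I_n).
Hypothesis esym : symmetric e.
Hypothesis eirr : irreflexive e.
Hypothesis ab : e a b.
Hypothesis cd : e c d.
Hypothesis nac : ~~ e a c.
Hypothesis nbd : ~~ e b d.
Hypothesis nad : a != d.
Hypothesis nbc : b != c.
Hypothesis ac : a != c.
Hypothesis bd : b != d.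

Definition is_pair (u v x y : 'I_n) :=
  (x == u) && (y == v) || (x == v) && (y == u).

Definition switch : rel 'I_n :=
  [rel x y | [|| del (del e a b) c d x y, is_pair a c x y | is_pair b d x y]].

Lemma is_pair_sym u v x y : is_pair u v x y = is_pair u v y x.
Proof. by rewrite /is_pair orbC (andbC (x == v)) (andbC (x == u)). Qed.

Lemma switch_sym : symmetric switch.
Proof. by move=> x y; rewrite /switch /= del2_sym // !(is_pair_sym _ _ x). Qed.

Lemma switch_irr : irreflexive switch.
Proof.
move=> x; rewrite /switch /= /del /= eirr /is_pair /=.
have [->|_] := eqVneq x a; first by rewrite (negPf ac) (negPf nad) /= ?andbF.
have [->|_] := eqVneq x b; first by rewrite (negPf nbc) (negPf bd) /= ?andbF.
by rewrite !andbF.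
Qed.

Lemma is_pairE u v x y : is_pair u v x y -> (x = u /\ y = v) \/ (x = v /\ y = u).
Proof. by case/orP=> /andP[/eqP-> /eqP->]; [left|right]. Qed.

(** The deleted pairs are added on the left so that no truncated subtraction occurs. *)
Lemma switch_count x y : (switch x y + is_pair a b x y + is_pair c d x y =
  e x y + is_pair a c x y + is_pair b d x y)%N.
Proof.
have nab := edge_neq eirr ab; have ncd := edge_neq eirr cd.
have in1 : is_pair a b x y -> e x y by case/is_pairE=> [][-> ->] //; rewrite esym.
have in2 : is_pair c d x y -> e x y by case/is_pairE=> [][-> ->] //; rewrite esym.
have in3 : is_pair a c x y -> ~~ e x y by case/is_pairE=> [][-> ->] //; rewrite esym.
have in4 : is_pair b d x y -> ~~ e x y by case/is_pairE=> [][-> ->] //; rewrite esym.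
have n1 : ~~ (is_pair a b x y && is_pair c d x y).
  apply/negP=> /andP[/is_pairE[][-> ->] /is_pairE[][/eqP E _]]; move: E;
  by rewrite ?(eq_sym c b) ?(negPf nab) ?(negPf ncd) ?(negPf ac) ?(negPf nad) ?(negPf nbc) ?(negPf bd).
have n2 : ~~ (is_pair a c x y && is_pair b d x y).
  apply/negP=> /andP[/is_pairE[][-> ->] /is_pairE[][/eqP E _]]; move: E;
  by rewrite ?(eq_sym c b) ?(negPf nab) ?(negPf ncd) ?(negPf ac) ?(negPf nad) ?(negPf nbc) ?(negPf bd).
have -> : switch x y = [|| [&& e x y, ~~ is_pair a b x y & ~~ is_pair c d x y],
    is_pair a c x y | is_pair b d x y].
  by rewrite /switch /del /is_pair /= !negb_or !andbA.
by move: in1 in2 in3 in4 n1 n2; case: (e x y); case: (is_pair a b x y);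
  case: (is_pair c d x y); case: (is_pair a c x y); case: (is_pair b d x y) => //= H1 H2 H3 H4;
  do ?[have // := H1 isT | have // := H2 isT | have // := H3 isT | have // := H4 isT].
Qed.

Local Open Scope ring_scope.

Definition rel_sum (R : nzRingType) (F : 'I_n -> 'I_n -> R) (e' : rel 'I_n) : R :=
  \sum_x \sum_y (e' x y)%:R * F x y.

Lemma rel_sum_pair (R : nzRingType) (F : 'I_n -> 'I_n -> R) u v : u != v ->
  rel_sum F (is_pair u v) = F u v + F v u.
Proof.
move=> uv; rewrite /rel_sum pair_bigA /=.
have uvn : (v, u) != (u, v) by rewrite xpair_eqE eq_sym (negPf uv).
rewrite (bigD1 (u, v)) //= (bigD1 (v, u)) //= big1 => [|[x y] /= /andP[]].
  by rewrite /is_pair !eqxx orbT !mul1r addr0.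
by rewrite !xpair_eqE /is_pair => /negPf-> /negPf->; rewrite mul0r.
Qed.

Lemma rel_sum_switch (R : nzRingType) (F : 'I_n -> 'I_n -> R) :
  rel_sum F switch + (F a b + F b a) + (F c d + F d c) =
  rel_sum F e + (F a c + F c a) + (F b d + F d b).
Proof.
have nab := edge_neq eirr ab; have ncd := edge_neq eirr cd.
rewrite -!rel_sum_pair // /rel_sum -!big_split /=; apply: eq_bigr => x _.
rewrite -!big_split /=; apply: eq_bigr => y _.
by rewrite -!mulrDl -!natrD switch_count.
Qed.

(** A surviving walk between the new edges [ac] and [bd] links all four vertices, which replaces the
    deleted edges [ab] and [cd]. *)
Lemma switch_connect x y : (forall u v, connect e u v) ->
  x \in [:: a; c] -> y \in [:: b; d] -> connect (del (del e a b) c d) x y ->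
  forall u v, connect switch u v.
Proof.
move=> ec xac ybd cxy.
have sC := sym_connect_sym switch_sym.
have cac : connect switch a c by apply: connect1; rewrite /switch /= /is_pair !eqxx !orbT.
have cbd : connect switch b d by apply: connect1; rewrite /switch /= /is_pair !eqxx !orbT.
have cab : connect switch a b.
  have c1 : connect switch x y.
    by apply: connect_mono cxy => u v uv; rewrite /switch /= uv.
  have c2 : connect switch a x by move: xac; rewrite !inE => /orP[]/eqP->; rewrite ?connect0.
  have c3 : connect switch y b.
    by move: ybd; rewrite !inE sC => /orP[]/eqP->; rewrite ?connect0.
  exact: connect_trans c2 (connect_trans c1 c3).
have ccd : connect switch c d.
  by rewrite sC in cac; apply: connect_trans cac (connect_trans cab cbd).
move=> u v; apply: connect_sub (ec u v) => u' v' uv.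
case: (boolP (is_pair a b u' v')) => [/is_pairE[][-> ->]//|n1]; first by rewrite sC.
case: (boolP (is_pair c d u' v')) => [/is_pairE[][-> ->]//|n2]; first by rewrite sC.
apply: connect1; rewrite /switch /= /del /= uv.
by move: n1 n2; rewrite /is_pair !negb_or => -> ->.
Qed.

End Switch.

(** * Existence of a swap-optimal realization *)

Section Optimum.

Import Order.TTheory GRing.Theory Num.Theory.

Variables (R : realType) (f : R -> R -> R) (pi : seq nat).
Hypothesis f_sym : symmetric_on_pos f.
Hypothesis f_esc : forall x1 x2 y1 y2 : R,
  (0 < y1 -> y1 <= x1 -> 0 < y2 -> y2 <= x2 -> f x2 y1 + f x1 y2 <= f x1 x2 + f y1 y2)%R.
Hypothesis pi_sorted : sorted geq pi.

Definition realizes (e : rel 'I_(size pi)) : Prop :=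
  [/\ symmetric e, irreflexive e, forall x y, connect e x y &
      forall x, #|[set y | e x y]| = nth 0 pi x].

Lemma nth_pi_mono (x y : 'I_(size pi)) : x < y -> nth 0 pi y <= nth 0 pi x.
Proof.
move=> xy; have := sorted_leq_nth _ _ 0 pi_sorted x y; apply.
- by move=> ? ? ? ? /leq_trans; apply.
- exact: leqnn.
- by rewrite inE.
- by rewrite inE.
- exact: ltnW.
Qed.

Lemma realizes_switch e a b c d x y : realizes e -> e a b -> e c d ->
  ~~ e a c -> ~~ e b d -> a != d -> b != c -> a != c -> b != d ->
  x \in [:: a; c] -> y \in [:: b; d] -> connect (del (del e a b) c d) x y ->
  realizes (switch e a b c d).
Proof.
move=> [es ei ec ed] ab cd nac nbd ad bc ac bd xac ybd cxy; split.
- exact: switch_sym.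
- exact: switch_irr.
- exact: switch_connect xac ybd cxy.
move=> u; rewrite -ed; apply/eqP; rewrite -(eqr_nat R).
(* The degree of [u] is the relation sum of the indicator of [v = u]. The indicator terms of removed
   and added edges agree, since each of [a], [b], [c], [d] loses one edge and gains one. *)
have degE (e' : rel 'I_(size pi)) :
    (#|[set z | e' u z]|%:R = rel_sum (fun v _ => (v == u)%:R : R) e')%R.
  rewrite /rel_sum (bigD1 u) //= [X in (_ + X)%R]big1 ?addr0 => [|v /negPf vu]; last first.
    by apply: big1 => z _; rewrite vu mulr0.
  rewrite -sum1_card natr_sum big_mkcond /=; apply: eq_bigr => z _.
  by rewrite inE eqxx mulr1; case: (e' u z).
rewrite !degE; apply/eqP.
have := rel_sum_switch es ei ab cd nac nbd ad bc ac bd (fun v _ => (v == u)%:R : R)%R.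
set A := rel_sum _ _; set B := rel_sum _ _; lra.
Qed.

Local Open Scope ring_scope.

Definition weight (x y : 'I_(size pi)) : R := f (nth 0%N pi x)%:R (nth 0%N pi y)%:R.

Lemma exists_optimum : (exists e, realizes e) -> exists e,
  [/\ realizes e, forall e', realizes e' -> rel_sum weight e' <= rel_sum weight e &
      swap_optimal e].
Proof.
(* Relations are encoded as sets of pairs so that the maximum ranges over a finite type. *)
pose rl (E : {set 'I_(size pi) * 'I_(size pi)}) : rel 'I_(size pi) :=
  fun x y => (x, y) \in E.
pose st (e : rel 'I_(size pi)) := [set p | e p.1 p.2].
have stK e : rl (st e) = e.
  by apply/funext => x; apply/funext => y; rewrite /rl inE.
case=> e0 re0; pose P E := `[< realizes (rl E) >].
have Pst e : realizes e -> P (st e) by move=> re; apply/asboolP; rewrite stK.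
pose E1 := [arg max_(E > st e0 | P E) rel_sum weight (rl E)]%O.
have [PE1 maxE1] : P E1 /\ forall E, P E -> rel_sum weight (rl E) <= rel_sum weight (rl E1).
  by rewrite /E1; case: Order.TotalTheory.arg_maxP => [|E PE mE]; [exact: Pst|split].
(* Ties are broken by the sum of [i * j] over the edges, which every admissible
   swap strictly increases. *)
pose idx (x y : 'I_(size pi)) : R := (nat_of_ord x)%:R * (nat_of_ord y)%:R.
pose Q E := P E && (rel_sum weight (rl E) == rel_sum weight (rl E1)).
have QE1 : Q E1 by rewrite /Q PE1 eqxx.
pose E2 := [arg max_(E > E1 | Q E) rel_sum idx (rl E)]%O.
have [QE2 maxE2] : Q E2 /\ forall E, Q E -> rel_sum idx (rl E) <= rel_sum idx (rl E2).
  by rewrite /E2; case: Order.TotalTheory.arg_maxP => // E QE mE; split.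
case/andP: QE2 => /asboolP re2 /eqP eq2; exists (rl E2); split=> //.
  by move=> e' re'; rewrite eq2 -(stK e'); apply: maxE1; apply: Pst.
set e := rl E2 in re2 eq2 maxE2 *.
move=> a b c d ab cd ltad ltcb nac nbd ac bd x y xac ybd; apply/negP => cxy.
have ad : a != d by rewrite -val_eqE /= ltn_eqF.
have bc : b != c by rewrite eq_sym -val_eqE /= ltn_eqF.
have rs := realizes_switch re2 ab cd nac nbd ad bc ac bd xac ybd cxy.
case: (re2) => es ei ec ed.
have pos u v : e u v -> 0 < (nth 0%N pi u)%:R :> R.
  by move=> uv; rewrite ltr0n -ed; apply/card_gt0P; exists v; rewrite inE.
have pa := pos _ _ ab; have pc := pos _ _ cd.
have pb : 0 < (nth 0%N pi b)%:R :> R by apply: (pos b a); rewrite es.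
have pd : 0 < (nth 0%N pi d)%:R :> R by apply: (pos d c); rewrite es.
have lead : (nth 0%N pi d)%:R <= (nth 0%N pi a)%:R :> R by rewrite ler_nat nth_pi_mono.
have lecb : (nth 0%N pi b)%:R <= (nth 0%N pi c)%:R :> R by rewrite ler_nat nth_pi_mono.
have W := rel_sum_switch es ei ab cd nac nbd ad bc ac bd weight.
have I := rel_sum_switch es ei ab cd nac nbd ad bc ac bd idx.
have leW : rel_sum weight e <= rel_sum weight (switch e a b c d).
  have := f_esc pd lead pb lecb; move: W; rewrite /weight.
  rewrite (f_sym pb pa) (f_sym pd pc) (f_sym pc pa) (f_sym pd pb).
  set A := rel_sum _ _; set B := rel_sum _ _; lra.
have Qs : Q (st (switch e a b c d)).
  by rewrite /Q Pst // stK eq_le -{2}eq2 leW andbT -{1}(stK (switch e a b c d)) maxE1 ?Pst.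
have := maxE2 _ Qs; rewrite stK leNgt => /negP; apply.
have la : (nat_of_ord a)%:R < (nat_of_ord d)%:R :> R by rewrite ltr_nat.
have lc : (nat_of_ord c)%:R < (nat_of_ord b)%:R :> R by rewrite ltr_nat.
move: I; rewrite /idx; set A := rel_sum _ _; set B := rel_sum _ _.
(* Over ordered pairs the gain is twice the product of [d - a] and [b - c]. *)
have := mulr_gt0 (_ : 0 < (nat_of_ord d)%:R - (nat_of_ord a)%:R :> R)
                 (_ : 0 < (nat_of_ord b)%:R - (nat_of_ord c)%:R :> R).
by rewrite !subr_gt0 => /(_ la lc); lra.
Qed.

End Optimum.

(** * Passage from graphs to relations on labels *)

Section Relabel.

Import GRing.Theory.

Variables (H : graph) (pi : seq nat).
Hypothesis cH : connected H.
Hypothesis dH : degseq H = pi.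

Lemma degseq_labelling : exists2 g : 'I_(size pi) -> H,
  bijective g & forall i, deg (g i) = nth 0 pi i.
Proof.
case/card_gt0P: cH.1 => x0 _.
pose s := sort (relpre (@deg H) geq) (enum H).
have ds : [seq deg v | v <- s] = pi by rewrite /s -sort_map.
have ss : size s = size pi by rewrite -ds size_map.
exists (fun i : 'I_(size pi) => nth x0 s i); last first.
  by move=> i; rewrite -{2}ds (nth_map x0) // ss.
apply: inj_card_bij.
  move=> i j /eqP; rewrite nth_uniq ?ss //; last by rewrite sort_uniq enum_uniq.
  by move=> /eqP/val_inj.
by rewrite card_ord -ss size_sort cardE.
Qed.

Lemma relabel_realizes : exists2 e : rel 'I_(size pi), realizes e &
  forall (R : realType) (f : R -> R -> R), pair_sum H f = rel_sum (weight f (pi := pi)) e.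
Proof.
have [g gb gd] := degseq_labelling; case: (gb) => g' gK g'K.
exists (fun i j => adj (g i) (g j)); last first.
  move=> R f; rewrite /pair_sum /rel_sum (reindex g (onW_bij _ gb)).
  apply: eq_bigr => i _; rewrite (reindex g (onW_bij _ gb)).
  by apply: eq_bigr => j _; rewrite /weight !gd.
split.
- by move=> i j; rewrite adj_sym.
- by move=> i; rewrite adj_irr.
- move=> i j; rewrite -(gK i) -(gK j); apply: connect_hom (cH.2 (g i) (g j)) => x y xy.
  by apply: connect1; rewrite !g'K.
move=> i; rewrite -gd /deg -(on_card_preimset (onW_bij _ gb)).
by apply: eq_card => j; rewrite !inE.
Qed.

Lemma sum_degseq : \sum_(u : H) deg u = \sum_(i < size pi) nth 0 pi i.
Proof.
have [g gb gd] := degseq_labelling; rewrite (reindex g (onW_bij _ gb)).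
by apply: eq_bigr => i _; rewrite gd.
Qed.

Lemma card_degseq : #|H| = size pi.
Proof. by rewrite -dH size_sort size_map cardE. Qed.

End Relabel.

Lemma realizes_sym pi (e : rel 'I_(size pi)) : realizes e -> symmetric e.
Proof. by case. Qed.

Lemma realizes_irr pi (e : rel 'I_(size pi)) : realizes e -> irreflexive e.
Proof. by case. Qed.

Definition realizing_graph pi (e : rel 'I_(size pi)) (er : realizes e) : graph :=
  Graph (realizes_sym er) (realizes_irr er).

(** * The graph of a swap-optimal relation *)

Section Assembly.

Import Order.TTheory GRing.Theory Num.Theory.

Variables (pi : seq nat) (e : rel 'I_(size pi)).
Hypothesis pi_sorted : sorted geq pi.
Hypothesis er : realizes e.
Hypothesis opt : swap_optimal e.
Hypothesis pi_gt0 : 0 < size pi.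

Let e_sym : symmetric e := realizes_sym er.
Let e_irr : irreflexive e := realizes_irr er.
Notation G := (realizing_graph er).

Lemma realizes_deg x : #|[set y | e x y]| = nth 0 pi x.
Proof. by case: er. Qed.

Lemma realizes_connected : connected G.
Proof. by split; [rewrite /= card_ord|case: er]. Qed.

Lemma realizes_degs : [seq deg v | v <- enum G] = pi.
Proof.
apply: (@eq_from_nth _ 0); rewrite size_map size_enum_ord // => i i_lt.
by rewrite (nth_map (Ordinal i_lt)) ?size_enum_ord // [deg _]realizes_deg nth_enum_ord.
Qed.

Lemma realizes_Gamma : Gamma pi G.
Proof.
split; first exact: realizes_connected.
rewrite /degseq realizes_degs sorted_sort // => x y z yx zy.
exact: leq_trans zy yx.
Qed.

Lemma realizes_pair_sum (R : realType) (f : R -> R -> R) :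
  pair_sum G f = rel_sum (weight f (pi := pi)) e.
Proof. by apply: eq_bigr => x _; apply: eq_bigr => y _; rewrite /weight -!realizes_deg. Qed.

Let dmono (x y : 'I_(size pi)) : x < y -> #|[set z | e y z]| <= #|[set z | e x z]|.
Proof. by rewrite !realizes_deg; apply: nth_pi_mono. Qed.

Let dist_parent' (r : G) := dist_parent realizes_connected (u := r).
Let dist_lip' (r : G) := @dist_lip G realizes_connected r.

Lemma dist_le_mono (r x y : G) : nat_of_ord r = 0 ->
  nat_of_ord x <= nat_of_ord y -> dist r x <= dist r y.
Proof.
move=> r0; apply: (le_level e_sym e_irr (dist_root r) (@dist_lip' r)
  (@dist_parent' r) r0 dmono opt).
Qed.

Lemma enum_BFS_ordering : BFS_ordering (enum G).
Proof.
split; first exact: perm_refl.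
case E : (enum G) => [|r s].
  by have := size_enum_ord (size pi); rewrite [enum _]E => /esym s0; move: pi_gt0; rewrite s0.
have r0 : nat_of_ord r = 0.
  by have := nth_enum_ord r pi_gt0; rewrite [enum _]E.
rewrite -E realizes_degs; split=> //.
- have sE : size (enum G) = size pi by exact: size_enum_ord.
  apply/(sortedP 0) => i; rewrite size_map sE => i_lt.
  have i_lt' := ltnW i_lt.
  have nthE j : j < size pi ->
      nth 0 [seq dist r v | v <- enum G] j = dist r (nth r (enum G) j).
    by move=> j_lt; rewrite (nth_map r) ?sE.
  rewrite !nthE //.
  apply: dist_le_mono => //.
  by rewrite [X in X <= _]nth_enum_ord ?[X in _ <= X]nth_enum_ord.
- move=> u w v z; rewrite !inE => /andP[nwv uv] /andP[nuz wz] hw hv hz.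
  rewrite /before !index_enum_ord.
  exact: (children_ordered e_sym (dist_root r) (@dist_parent' r) r0 opt uv nwv wz nuz hw hv hz).
Qed.

Lemma top_triangle (r p q l : G) : nat_of_ord r = 0 -> nat_of_ord p = 1 ->
  nat_of_ord q = 2 -> nth 0 pi l = 1 -> (size pi).*2 <= \sum_(i < size pi) nth 0 pi i ->
  [/\ adj r p, adj p q & adj r q].
Proof.
move=> r0 p1 q2 l1 le2.
have le2' : (size pi).*2 <= \sum_x #|[set y | e x y]|.
  by under eq_bigr do rewrite realizes_deg.
have r3 : 2 < #|[set y | e r y]|.
  by apply: (@max_deg_gt2 _ e r l) => //; rewrite realizes_deg.
have [x [y1 [y2 [y12 xy l1' l2]]]] := two_lower_neighbors e_sym e_irr r0 le2'.
apply: (triangle_of_cycle e_sym e_irr (dist_root r) (@dist_lip' r) (@dist_parent' r) r0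
  dmono opt r3 p1 q2 (x := x)).
by exists y1, y2; split=> //; apply: dist_le_mono => //; apply: ltnW.
Qed.

End Assembly.

Lemma degseq_sorted G : sorted geq (degseq G).
Proof. by apply: sort_sorted => x y; apply: leq_total. Qed.

(** * Extremal graphs for escalating and de-escalating functions *)

Section Main.

Import Order.TTheory GRing.Theory Num.Theory.
Local Open Scope ring_scope.

Lemma optimal_BFS_graph (R : realType) (f : R -> R -> R) (c : nat) (pi : seq nat) :
  symmetric_on_pos f ->
  (forall x1 x2 y1 y2 : R, 0 < y1 -> y1 <= x1 -> 0 < y2 -> y2 <= x2 ->
    f x2 y1 + f x1 y2 <= f x1 x2 + f y1 y2) ->
  cyclic_degseq c pi -> last 0%N pi = 1%N ->
  exists G : graph, [/\ Gamma pi G,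
    forall H, Gamma pi H -> pair_sum H f <= pair_sum G f, BFS_graph G &
    (1 <= c)%N -> exists (v1 v2 v3 : G) (s : seq G),
       [/\ BFS_ordering [:: v1, v2, v3 & s],
           [seq deg v | v <- [:: v1, v2, v3 & s]] = pi &
           [/\ adj v1 v2, adj v2 v3 & adj v1 v3]]].
Proof.
move=> f_sym f_esc [G0 [cG0 eG0] dG0] pi_last.
have pi_sorted : sorted geq pi by rewrite -dG0 degseq_sorted.
have pi_gt0 : (0 < size pi)%N by case: (pi) pi_last.
have [e0 re0 _] := relabel_realizes cG0 dG0.
have [e [re emax eopt]] := exists_optimum f_sym f_esc pi_sorted (ex_intro _ e0 re0).
have pair_le H : Gamma pi H -> pair_sum H f <= pair_sum (realizing_graph re) f.
  case=> cH dH; have [e' re' ->] := relabel_realizes cH dH.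
  by rewrite realizes_pair_sum emax.
have bfs := enum_BFS_ordering pi_sorted re eopt pi_gt0.
exists (realizing_graph re); split=> //; first exact: realizes_Gamma.
  by exists (enum (realizing_graph re)).
move=> c1; have degs := realizes_degs re.
have l_lt : ((size pi).-1 < size pi)%N by rewrite prednK.
have l1 : nth 0%N pi (Ordinal l_lt) = 1%N by rewrite /= nth_last.
(* The degree sum is twice [n + c - 1], and [c >= 1]. *)
have le2 : ((size pi).*2 <= \sum_(i < size pi) nth 0 pi i)%N.
  rewrite -(sum_degseq cG0 dG0) [X in (_ <= X)%N]sum_deg_edges eG0 (card_degseq dG0).
  by rewrite leq_double -addnBA // leq_addr.
have size3 : (2 < size pi)%N.
  pose r := Ordinal pi_gt0.
  have := max_card (mem [set y | e r y]); rewrite card_ord; apply: leq_trans.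
  apply: (@max_deg_gt2 _ e r (Ordinal l_lt)) => //.
  - by move=> x y; rewrite !(realizes_deg re); apply: nth_pi_mono.
  - by rewrite (realizes_deg re).
  - by under eq_bigr do rewrite (realizes_deg re).
have enum_nth (v : realizing_graph re) i : (i < size pi)%N ->
    nat_of_ord (nth v (enum (realizing_graph re)) i) = i by exact: nth_enum_ord.
have := size_enum_ord (size pi); rewrite -[enum _]/(enum (realizing_graph re)).
case E : (enum (realizing_graph re)) bfs degs enum_nth => [|v1 [|v2 [|v3 s]]] bfs degs enum_nth Es;
  rewrite -Es // in size3 *.
exists v1, v2, v3, s; split=> //.
apply: (@top_triangle pi e pi_sorted re eopt pi_gt0 v1 v2 v3 (Ordinal l_lt)) => //.
- exact: (enum_nth v1 0%N).
- by apply: (enum_nth v1 1%N); rewrite -Es.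
- by apply: (enum_nth v1 2%N); rewrite -Es.
Qed.

Lemma pair_sumN (R : realType) (f : R -> R -> R) (G : graph) :
  pair_sum G (fun x y => - f x y) = - pair_sum G f.
Proof.
rewrite /pair_sum -sumrN; apply: eq_bigr => u _; rewrite -sumrN.
by apply: eq_bigr => v _; rewrite mulrN.
Qed.

Lemma extremal_BFS_graph (R : realType) (f : R -> R -> R) (c : nat) (pi : seq nat) :
  symmetric_on_pos f -> escalating f \/ deescalating f ->
  cyclic_degseq c pi -> last 0%N pi = 1%N ->
  exists G : graph, [/\ extremal f (Gamma pi) G, BFS_graph G &
    (1 <= c)%N -> exists (v1 v2 v3 : G) (s : seq G),
       [/\ BFS_ordering [:: v1, v2, v3 & s],
           [seq deg v | v <- [:: v1, v2, v3 & s]] = pi &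
           [/\ adj v1 v2, adj v2 v3 & adj v1 v3]]].
Proof.
move=> f_sym f_esc pi_cyclic pi_last; case: (f_esc) => fe.
  have esc x1 x2 y1 y2 p1 l1 p2 l2 := (fe x1 x2 y1 y2 p1 l1 p2 l2).1.
  have [G [GG Gmax bfs tri]] := optimal_BFS_graph f_sym esc pi_cyclic pi_last.
  exists G; split=> //; split=> //; left; split=> // H /Gmax.
  by rewrite !pair_sumE // lerMn2r.
(* Negation reverses the inequality and turns minima into maxima, which reduces to the escalating
   case. *)
pose f' (x y : R) := - f x y.
have f'_sym : symmetric_on_pos f' by move=> x y x0 y0; rewrite /f' f_sym.
have esc x1 x2 y1 y2 : 0 < y1 -> y1 <= x1 -> 0 < y2 -> y2 <= x2 ->
    f' x2 y1 + f' x1 y2 <= f' x1 x2 + f' y1 y2.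
  by move=> p1 l1 p2 l2; rewrite /f' -!opprD lerN2; case: (fe x1 x2 y1 y2 p1 l1 p2 l2).
have [G [GG Gmax bfs tri]] := optimal_BFS_graph f'_sym esc pi_cyclic pi_last.
exists G; split=> //; split=> //; right; split=> // H /Gmax.
by rewrite !pair_sumN lerN2 !pair_sumE // lerMn2r.
Qed.

End Main.

Theorem theorem3 (R : realType) (f : R -> R -> R)
  (f_sym : symmetric_on_pos f)
  (f_esc : escalating f \/ deescalating f)
  (c : nat) (pi : seq nat)
  (pi_cyclic : cyclic_degseq c pi)
  (pi_last : last 0 pi = 1) :
  (exists G : graph, extremal f (Gamma pi) G /\ BFS_graph G) /\
  (1 <= c ->
   exists G : graph, extremal f (Gamma pi) G /\
     exists (v1 v2 v3 : G) (s : seq G),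
       [/\ BFS_ordering [:: v1, v2, v3 & s],
           [seq deg v | v <- [:: v1, v2, v3 & s]] = pi &
           [/\ adj v1 v2, adj v2 v3 & adj v1 v3]]).
Proof.
have [G [exG bfs tri]] := extremal_BFS_graph f_sym f_esc pi_cyclic pi_last.
by split=> [|c1]; exists G; split=> //; apply: tri.
Qed.
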